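(* Let $\mathcal{H}$ be a separable complex Hilbert space and let $A_1,\dots,A_n\in C_p$ for some $p>0$. Then $$\sum_{i=1}^n\Big\|A_i-\frac1n\sum_{j=1}^n A_j\Big\|_p^2\le n^{\frac2p-1}\sum_{i=1}^n\|A_i\|_p^2-n\Big\|\frac1n\sum_{j=1}^n A_j\Big\|_p^2$$ for $0<p<2$; and $$n^{\frac2p-1}\sum_{i=1}^n\|A_i\|_p^2-n\Big\|\frac1n\sum_{j=1}^n A_j\Big\|_p^2\le\sum_{i=1}^n\Big\|A_i-\frac1n\sum_{j=1}^n A_j\Big\|_p^2$$ for $2\le p<\infty$.
   Context: For a compact operator $A$ on $\mathcal{H}$ and $0<p<\infty$, $\|A\|_p=(\mathrm{tr}\,|A|^p)^{1/p}$, where $|A|=(A^*A)^{1/2}$ and $\mathrm{tr}$ is the usual trace (a norm for $p\ge1$, a quasi-norm for $0<p<1$). The Schatten $p$-class $C_p$ is the two-sided ideal of bounded operators on $\mathcal{H}$ consisting of the compact operators $A$ with $\|A\|_p<\infty$. *)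

(* Defs.v *)
From HB Require Import structures.
From mathcomp Require Import all_boot all_order all_algebra sesquilinear.
From mathcomp Require Import all_classical all_reals all_analysis.
From mathcomp Require Import complex.

Set Implicit Arguments.
Unset Strict Implicit.
Unset Printing Implicit Defensive.

Import Order.TTheory GRing.Theory Num.Theory.
Import numFieldNormedType.Exports.

Local Open Scope classical_set_scope.
Local Open Scope ring_scope.
Local Open Scope complex_scope.

(* A complex Hilbert space is a complete normed space H over R[i] together with
   a positive definite hermitian form ip, linear in its first argument and
   conjugate-linear in the second, such that norm_from_dot ip holds.
   Operators are plain functions H -> H, with the pointwise vector space
   structure; boundedness and linearity are carried by bounded_op. *)

Section Operators.
Variables (R : realType) (H : completeNormedModType R[i]).
Variable ip : {dot H for Num.conj}.
Implicit Types (A B S T : H -> H) (E : set H).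

Definition norm_from_dot : Prop := forall x : H, `|x| ^+ 2 = ip x x.

Definition separable_space : Prop :=
  exists2 D : set H, countable D & dense D.

Definition bounded_op T : Prop := linear T /\ continuous T.

Definition compact_op T : Prop :=
  bounded_op T /\ compact (closure (T @` [set x : H | `|x| <= 1])).

Definition adjoint_of A B : Prop :=
  bounded_op B /\ forall x y, ip (A x) y = ip x (B y).

Definition adjoint A : H -> H := xget 0 [set B | adjoint_of A B].

(* The order of R[i] makes 0 <= z mean that z is real and nonnegative. *)
Definition positive_op T : Prop :=
  bounded_op T /\ forall x, 0 <= ip (T x) x.

Definition op_sqrt S : H -> H :=
  xget 0 [set T | positive_op T /\ T \o T = S].

Definition op_abs A : H -> H := op_sqrt (adjoint A \o A).

(* In a Hilbert space, an orthonormal set is a basis iff it is maximal, i.e.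
   iff no nonzero vector is orthogonal to it. *)
Definition orthonormal_basis E : Prop :=
  [/\ forall e, E e -> ip e e = 1,
      forall e f, E e -> E f -> e <> f -> ip e f = 0
    & forall x, (forall e, E e -> ip x e = 0) -> x = 0].

(* Functional calculus t |-> t ^ r for a compact positive operator S (r > 0):
   by the spectral theorem S is diagonal in an orthonormal basis of
   eigenvectors, with eigenvalues s e >= 0, and S ^ r is the bounded operator
   that is diagonal in this basis with eigenvalues (s e) ^ r. *)
Definition op_power_of S (r : R) T : Prop :=
  bounded_op T /\
  exists E (s : H -> R), orthonormal_basis E /\
    forall e, E e ->
      [/\ 0 <= s e, S e = (s e)%:C *: e & T e = (s e `^ r)%:C *: e].

Definition op_power S (r : R) : H -> H := xget 0 [set T | op_power_of S r T].

(* The trace of a positive operator, in [0, +oo]: the sum of the (real)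
   numbers <T e, e> over an orthonormal basis; for such T the value does not
   depend on the basis. *)
Definition op_trace T : \bar R :=
  (\esum_(e in xget set0 [set E | orthonormal_basis E])
    (complex.Re (ip (T e) e))%:E)%E.

Definition schatten_norm (p : R) A : \bar R :=
  (op_trace (op_power (op_abs A) p) `^ p^-1)%E.

Definition schatten_class (p : R) A : Prop :=
  compact_op A /\ (schatten_norm p A < +oo)%E.

End Operators.

Definition op_mean (R : realType) (H : completeNormedModType R[i]) (n : nat)
    (A : 'I_n -> H -> H) : H -> H :=
  (n%:R : R[i])^-1 *: \sum_(j < n) A j.

(* Main.v *)
(* For positive compact forms [X_j] with sum [X], two trace inequalities hold for
   [q >= 1] and are reversed for [0 < q <= 1]:
     [|| X ||_q <= sum_j || X_j ||_q]  and  [sum_j tr X_j^q <= tr X^q].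
   They are applied with [q = p / 2] to the two decompositions
     [sum_i |A_i|^2 = sum_i |A_i - M|^2 + n |M|^2]    ([M] the mean of the [A_i])
   of one and the same operator, using [|| |B|^2 ||_q = ||B||_p^2]; the power mean
   inequality in [n] variables then gives the factor [n ^ (2 / p - 1)].

   Both trace inequalities follow from one scalar fact: if [s = w t] with [w] a
   doubly substochastic matrix, Jensen's inequality compares [sum s^q] and
   [sum t^q].  In the first one [w] consists of the numbers [|<u, e>|^2] for
   eigenbases [u] of [X] and [e] of [X_j] (followed by Minkowski's inequality in
   [l^q]), in the second one of [s_e |<e, u>|^2 / t_u], where [s_e] and [t_u] are
   the eigenvalues of [X_j] and [X].  Hence only the quadratic forms, expanded in
   eigenbases, are needed. *)
Require Import Defs.
From HB Require Import structures.
From mathcomp Require Import all_boot all_order all_algebra sesquilinear.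
From mathcomp Require Import all_classical all_reals all_analysis.
From mathcomp Require Import complex.
From mathcomp Require Import ring lra.
Import Order.TTheory GRing.Theory Num.Theory.
Import numFieldNormedType.Exports.
Local Open Scope classical_set_scope.
Local Open Scope ring_scope.

(** The operators [|A_i|^2] need not commute, so no common eigenbasis is available. Each change of
    eigenbasis costs an application of Jensen's inequality, whose direction is fixed by the
    convexity or concavity of [t ^ (p / 2)]; this is why the two regimes meet at [p = 2]. A second
    obstacle is the definition of the norm: adjoint, square root, power and the basis of the trace
    are picked by choice. Each must be shown to exist, and the norm must be computed whatever is
    picked. The spectral theorem supplies existence; positivity of the square root and Parseval's
    identity take care of the choices. Traces live in [[0, +oo]] and are unordered sums, so
    exchanging sums asks only for nonnegativity, and the norm of the mean may be infinite until the
    very end, where the difference in the statement has to be handled. *)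

(** * Young's inequality and unordered sums *)

Section EsumComplements.
Set Implicit Arguments.
Unset Strict Implicit.
Variable R : realType.
Implicit Types q s t : R.

(** The tangent at [s] lies below the graph of the convex function [t ^ q]. It is Young's inequality
    for [t] and [s ^ (q - 1)] with exponents [q] and [q / (q - 1)], cleared of denominators; [q = 1]
    has no finite conjugate exponent and is treated apart. *)
Lemma young_powR_ge1 q s t : 1 <= q -> 0 <= s -> 0 <= t ->
  q * s `^ (q - 1) * t <= t `^ q + (q - 1) * s `^ q.
Proof.
rewrite le_eqVlt => /predU1P[<- _ t0|q1 s0 t0].
  by rewrite subrr powRr0 powRr1// !mul1r mul0r addr0.
have q0 : 0 < q by lra.
have q10 : 0 < q - 1 by lra.
have := @conjugate_powR R t (s `^ (q - 1)) q (q / (q - 1)) t0 (powR_ge0 _ _) q0.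
rewrite divr_gt0// => /(_ isT).
have -> : q^-1 + (q / (q - 1))^-1 = 1 by field; lra.
move=> /(_ erefl); rewrite -powRrM.
have -> : (q - 1) * (q / (q - 1)) = q by field; lra.
move=> /(ler_wpM2l (ltW q0)).
have -> : q * (t `^ q / q + s `^ q / (q / (q - 1))) =
  t `^ q + (q - 1) * s `^ q by field; lra.
by rewrite (mulrC t) mulrA.
Qed.

(** The tangent at [s] of the concave function [t ^ q], multiplied by [s ^ (1 - q)] so that no
    negative power appears at [s = 0]. *)
Lemma young_powR_le1 q s t : 0 < q <= 1 -> 0 <= s -> 0 <= t ->
  t `^ q * s `^ (1 - q) <= q * t + (1 - q) * s.
Proof.
move=> /andP[q0]; rewrite le_eqVlt => /predU1P[-> s0 t0|q1 s0 t0].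
  by rewrite subrr powRr0 powRr1// mulr1 mul1r mul0r addr0.
have q10 : 0 < 1 - q by lra.
have := @conjugate_powR R (t `^ q) (s `^ (1 - q)) q^-1 (1 - q)^-1
  (powR_ge0 _ _) (powR_ge0 _ _).
rewrite !invr_gt0 !invrK => /(_ q0 q10).
have -> : q + (1 - q) = 1 by lra.
move=> /(_ erefl); rewrite -!powRrM !divff ?gt_eqF// !powRr1//.
by rewrite (mulrC t) (mulrC s).
Qed.

Section esum_lemmas.
Local Open Scope ereal_scope.
Variable T : choiceType.
Implicit Types (E : set T) (a b : T -> \bar R).

Lemma esumZl E a (c : R) : (0 <= c)%R -> (forall x, 0 <= a x) ->
  \esum_(x in E) (c%:E * a x) = c%:E * \esum_(x in E) a x.
Proof.
move=> c0 a0; rewrite -[RHS]ereal_supZl//; last first.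
  apply/set0P; exists 0; exists set0; first exact: fsets_set0.
  by rewrite fsbig_set0.
congr ereal_sup; apply/seteqP; split => [_ [X XE <-]|_ [_ [X XE <-] <-]].
  by exists (\sum_(x \in X) a x); [exists X|rewrite ge0_mule_fsumr].
by exists X => //; rewrite ge0_mule_fsumr.
Qed.

Lemma esum_fin (J : finType) (a : J -> \bar R) : (forall j, 0 <= a j) ->
  \esum_(j in [set: J]) a j = \sum_j a j.
Proof.
move=> a0; have -> : [set: J] = [set` index_enum J].
  by apply/seteqP; split => // j _ /=; rewrite mem_index_enum.
rewrite esum_fset//.
by rewrite -fsbig_seq// index_enum_uniq.
Qed.

Lemma le_esum_term E a x : (forall x, 0 <= a x) -> E x ->
  a x <= \esum_(x in E) a x.
Proof.
move=> a0 Ex; apply: esum_ge; exists [set x]; last by rewrite fsbig_set1.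
by split=> [|_ ->].
Qed.

End esum_lemmas.

Lemma exchange_esum (T1 T2 : choiceType) (A : set T1) (B : set T2)
    (f : T1 -> T2 -> \bar R) : (forall x y, (0 <= f x y)%E) ->
  (\esum_(x in A) \esum_(y in B) f x y = \esum_(y in B) \esum_(x in A) f x y)%E.
Proof.
move=> f0; rewrite !esum_esum//.
rewrite (@reindex_esum _ _ _ (A `*`` fun=> B) _ (fun z => (z.2, z.1)))//.
split=> [[x y]|[x y] [x' y']|[y x]] /=; first by case.
  by move=> _ _ [-> ->].
by case=> By Ax; exists (x, y).
Qed.


(** * Jensen, majorization and Minkowski inequalities for unordered sums *)

Section jensen.
Local Open Scope ereal_scope.
Variables (T : choiceType) (E : set T) (w t : T -> R) (q s : R).
Hypotheses (w0 : forall x, (0 <= w x)%R) (t0 : forall x, (0 <= t x)%R).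
Hypothesis sumw : \esum_(x in E) (w x)%:E <= 1.
Hypothesis sumwt : \esum_(x in E) (w x * t x)%:E = s%:E.

Let s0 : (0 <= s)%R.
Proof.
by rewrite -lee_fin -sumwt esum_ge0// => x _; rewrite lee_fin mulr_ge0.
Qed.

(** The tangent inequality at the mean [s] is summed against the weights. Total weight at most 1 is
    enough, since the constant term [(q - 1) * s ^ q] is nonnegative and stands on the larger
    side. *)
Lemma jensen_esum_ge1 : (1 <= q)%R ->
  (s `^ q)%:E <= \esum_(x in E) (w x * t x `^ q)%:E.
Proof.
move=> q1; have q0 : (0 < q)%R by lra.
have wt0 x : 0 <= (w x * t x `^ q)%:E by rewrite lee_fin mulr_ge0 ?powR_ge0.
have c0 : (0 <= (q - 1) * s `^ q)%R by rewrite mulr_ge0 ?powR_ge0; lra.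
have : \esum_(x in E) ((q * s `^ (q - 1))%:E * (w x * t x)%:E) <=
    \esum_(x in E) ((w x * t x `^ q)%:E + ((q - 1) * s `^ q)%:E * (w x)%:E).
  apply: le_esum => x _; rewrite -!EFinM -EFinD lee_fin.
  have := ler_wpM2l (w0 x) (young_powR_ge1 q1 s0 (t0 x)).
  by congr (_ <= _)%R; ring.
rewrite esumD; last 2 first.
- by move=> x _; exact: wt0.
- by move=> x _; rewrite mule_ge0 ?lee_fin.
rewrite !esumZl//; last 2 first.
- by rewrite mulr_ge0 ?powR_ge0 ?ltW.
- by move=> x; rewrite lee_fin mulr_ge0.
rewrite sumwt => le1.
have {le1} : (q * s `^ q)%:E <=
    \esum_(x in E) (w x * t x `^ q)%:E + ((q - 1) * s `^ q)%:E.
  apply: le_trans (le_trans le1 _).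
    by rewrite -EFinM lee_fin -mulrA (mulrC (_ `^ _)%R) mulr_powRB1.
  by rewrite leeD2l// -[leRHS]mule1 lee_wpmul2l.
by rewrite -leeBlDr// -EFinB; apply: le_trans; rewrite lee_fin; lra.
Qed.

Lemma jensen_esum_le1 : (0 < q <= 1)%R ->
  \esum_(x in E) (w x * t x `^ q)%:E <= (s `^ q)%:E.
Proof.
move=> q01; have /andP[q0 q1] := q01.
(* The tangent inequality carries a factor [s ^ (1 - q)] that can be cancelled only for [s > 0]; if
   [s = 0], every [w x * t x] vanishes. *)
move: s0; rewrite le_eqVlt => /predU1P[s00|s_gt0].
  rewrite esum1 ?lee_fin ?powR_ge0// => x Ex; congr (_%:E).
  have : (w x * t x)%:E <= 0.
    rewrite [X in _ <= X%:E]s00 -sumwt.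
    apply: (le_esum_term (a := fun x => (w x * t x)%:E)) => // y.
    by rewrite lee_fin mulr_ge0.
  rewrite lee_fin => wt; have /eqP : (w x * t x = 0)%R.
    by apply/eqP; rewrite eq_le wt mulr_ge0.
  by rewrite mulf_eq0 => /orP[]/eqP ->; rewrite ?mul0r// powR0 ?mulr0// gt_eqF.
have c0 : (0 < s `^ (1 - q))%R by rewrite powR_gt0.
rewrite -(@lee_pmul2l _ (s `^ (1 - q))%:E)//.
rewrite -esumZl//; [|exact: ltW|]; last first.
  by move=> x; rewrite lee_fin mulr_ge0 ?powR_ge0.
rewrite -EFinM -powRD; last by rewrite (gt_eqF s_gt0) implybT.
rewrite subrK powRr1//.
apply: (@le_trans _ _ 
  (\esum_(x in E) (q%:E * (w x * t x)%:E + ((1 - q) * s)%:E * (w x)%:E))).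
  apply: le_esum => x _; rewrite -!EFinM -EFinD lee_fin.
  have := ler_wpM2l (w0 x) (young_powR_le1 q01 s0 (t0 x)).
  by congr (_ <= _)%R; ring.
have c1 : (0 <= (1 - q) * s)%R by rewrite mulr_ge0 ?subr_ge0// ltW.
rewrite esumD; last 2 first.
- by move=> x _; rewrite mule_ge0 ?lee_fin ?mulr_ge0// ltW.
- by move=> x _; rewrite mule_ge0 ?lee_fin.
rewrite !esumZl//; last 2 first.
- exact: ltW.
- by move=> x; rewrite lee_fin mulr_ge0.
rewrite sumwt; apply: (@le_trans _ _ ((q * s)%:E + ((1 - q) * s)%:E)).
  by rewrite EFinM leeD2l// -[leRHS]mule1 lee_wpmul2l.
by rewrite -EFinD lee_fin; lra.
Qed.

End jensen.


Lemma jensen_sum_ge1 (J : finType) (w t : J -> R) q : 1 <= q ->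
  (forall j, 0 <= w j) -> (forall j, 0 <= t j) -> \sum_j w j <= 1 ->
  (\sum_j w j * t j) `^ q <= \sum_j w j * t j `^ q.
Proof.
move=> q1 w0 t0 w1; rewrite -lee_fin -[leRHS]sumEFin -esum_fin; last first.
  by move=> j; rewrite lee_fin mulr_ge0 ?powR_ge0.
apply: jensen_esum_ge1 => //.
  by rewrite esum_fin ?sumEFin ?lee_fin// => j; rewrite lee_fin.
by rewrite esum_fin ?sumEFin// => j; rewrite lee_fin mulr_ge0.
Qed.

Lemma jensen_sum_le1 (J : finType) (w t : J -> R) q : 0 < q <= 1 ->
  (forall j, 0 <= w j) -> (forall j, 0 <= t j) -> \sum_j w j <= 1 ->
  \sum_j w j * t j `^ q <= (\sum_j w j * t j) `^ q.
Proof.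
move=> q1 w0 t0 w1; rewrite -lee_fin -[leLHS]sumEFin -esum_fin; last first.
  by move=> j; rewrite lee_fin mulr_ge0 ?powR_ge0.
apply: jensen_esum_le1 => //.
  by rewrite esum_fin ?sumEFin ?lee_fin// => j; rewrite lee_fin.
by rewrite esum_fin ?sumEFin// => j; rewrite lee_fin mulr_ge0.
Qed.

Section majorization.
Local Open Scope ereal_scope.
Variables (T1 T2 : choiceType) (A : set T1) (B : set T2).
Variables (w : T1 -> T2 -> R) (s : T1 -> R) (t : T2 -> R) (q : R).
Hypotheses (w0 : forall x y, (0 <= w x y)%R) (t0 : forall y, (0 <= t y)%R).
Hypothesis sumw : forall x, A x -> \esum_(y in B) (w x y)%:E <= 1.
Hypothesis sumwt :
  forall x, A x -> \esum_(y in B) (w x y * t y)%:E = (s x)%:E.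

(** Row sums at most 1 allow Jensen in each row; after the exchange of sums, column sums at most 1
    bound the coefficient of each [t y ^ q]. *)
Lemma majorization_ge1 : (1 <= q)%R ->
  (forall y, B y -> \esum_(x in A) (w x y)%:E <= 1) ->
  \esum_(x in A) (s x `^ q)%:E <= \esum_(y in B) (t y `^ q)%:E.
Proof.
move=> q1 sumw'.
apply: (@le_trans _ _
  (\esum_(x in A) \esum_(y in B) (w x y * t y `^ q)%:E)).
  by apply: le_esum => x Ax; apply: jensen_esum_ge1; auto.
rewrite exchange_esum => [|x y]; last by rewrite lee_fin mulr_ge0 ?powR_ge0.
apply: le_esum => y By; under eq_esum do rewrite mulrC EFinM.
rewrite esumZl ?powR_ge0// => [|x]; last by rewrite lee_fin.
by rewrite -[leRHS]mule1 lee_wpmul2l ?lee_fin ?powR_ge0// sumw'.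
Qed.

(** Here the coefficient of [t y ^ q] must not drop below 1, so the columns have to sum to 1
    exactly; columns with [t y = 0] contribute nothing. *)
Lemma majorization_le1 : (0 < q <= 1)%R ->
  (forall y, B y -> (0 < t y)%R -> \esum_(x in A) (w x y)%:E = 1) ->
  \esum_(y in B) (t y `^ q)%:E <= \esum_(x in A) (s x `^ q)%:E.
Proof.
move=> q01 sumw'.
apply: (@le_trans _ _
  (\esum_(x in A) \esum_(y in B) (w x y * t y `^ q)%:E)); last first.
  by apply: le_esum => x Ax; apply: jensen_esum_le1; auto.
rewrite exchange_esum => [|x y]; last by rewrite lee_fin mulr_ge0 ?powR_ge0.
apply: le_esum => y By; under eq_esum do rewrite mulrC EFinM.
rewrite esumZl ?powR_ge0// => [|x]; last by rewrite lee_fin.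
have := t0 y; rewrite le_eqVlt => /predU1P[<-|ty].
  by rewrite powR0 ?mul0e//; case/andP: q01 => /gt_eqF ->.
by rewrite sumw'// mule1.
Qed.

End majorization.

Section minkowski.
Local Open Scope ereal_scope.
Variables (J : finType) (T : choiceType) (F : set T) (a : J -> T -> R).
Variables (M : J -> \bar R) (q : R).
Hypotheses (a0 : forall j x, (0 <= a j x)%R) (M0 : forall j, 0 <= M j).

(** With [N j = M j ^ (1 / q)] and [S] their sum, [sum_j a j] is the average of the
    [a j * (S / N j)] with weights [N j / S]. Jensen at each [x], then summation over [x], gives at
    most [sum_j (N j / S) * S ^ q = S ^ q]. *)
Lemma minkowski_esum_ge1 : (1 <= q)%R ->
  (forall j, \esum_(x in F) (a j x `^ q)%:E <= M j) ->
  (\esum_(x in F) ((\sum_j a j x) `^ q)%:E) `^ q^-1 <= \sum_j M j `^ q^-1.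
Proof.
move=> q1 aM; have q0 : (0 < q)%R by lra.
have [[j Mj]|Mfin] := pselect (exists j, M j = +oo).
  rewrite (bigD1 j)//= Mj poweRyr ?invr_eq0 ?gt_eqF// addye ?leey//.
  by rewrite -ltNye (lt_le_trans _ (sume_ge0 _ _))// => i _; rewrite poweR_ge0.
pose N j := (fine (M j) `^ q^-1)%R.
have N0 j : (0 <= N j)%R by rewrite powR_ge0.
have MN j : M j = (N j `^ q)%:E.
  rewrite -powRrM mulVf ?gt_eqF// powRr1 ?fine_ge0// fineK//.
  by rewrite ge0_fin_numE// ltey; apply/eqP => Mj; apply: Mfin; exists j.
set S := (\sum_j N j)%R.
have S0 : (0 <= S)%R by exact: sumr_ge0.
have -> : \sum_j M j `^ q^-1 = S%:E.
  rewrite -sumEFin; apply: eq_bigr => j _.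
  by rewrite MN poweR_EFin -powRrM mulfV ?gt_eqF// powRr1.
suff le : \esum_(x in F) ((\sum_j a j x) `^ q)%:E <= (S `^ q)%:E.
  have -> : S%:E = (S `^ q)%:E `^ q^-1.
    by rewrite poweR_EFin -powRrM mulfV ?gt_eqF// powRr1.
  apply: gt0_ler_poweR => //; rewrite ?invr_ge0 ?ltW// in_itv/= leey andbT.
    by rewrite esum_ge0// => x _; rewrite lee_fin powR_ge0.
  by rewrite lee_fin powR_ge0.
(* When [N j = 0] the term [N j / S * (a j x * (S / N j))] is 0 instead of [a j x]; the two agree
   because [a j] then vanishes on [F]. *)
have aN j x : F x -> N j = 0%R -> a j x = 0%R.
  move=> Fx Nj; apply/eqP.
  suff: (a j x `^ q == 0)%R by rewrite powR_eq0 => /andP[].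
  rewrite eq_le powR_ge0 andbT -lee_fin.
  have -> : 0%:E = M j by rewrite MN Nj powR0 ?gt_eqF.
  apply: le_trans (aM j).
  apply: (le_esum_term (a := fun x => (a j x `^ q)%:E)) => // y.
  by rewrite lee_fin powR_ge0.
(* The coefficient of [a j x ^ q] after Jensen has been applied with weights [N j / S] at the points
   [a j x * (S / N j)]. *)
pose c j := (N j / S * (S / N j) `^ q)%R.
have c0 j : (0 <= c j)%R by rewrite mulr_ge0 ?divr_ge0 ?powR_ge0.
apply: (@le_trans _ _
  (\esum_(x in F) \sum_j ((c j)%:E * (a j x `^ q)%:E))).
  apply: le_esum => x Fx.
  have -> : \sum_j ((c j)%:E * (a j x `^ q)%:E) =
      (\sum_j c j * a j x `^ q)%R%:E by rewrite -sumEFin.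
  rewrite lee_fin.
  have w1 : (\sum_j N j / S <= 1)%R.
    by rewrite -mulr_suml -/S; have [->|/divff->//] := eqVneq S 0%R; rewrite mul0r.
  have := jensen_sum_ge1 q1 (fun j => divr_ge0 (N0 j) S0)
    (fun j => mulr_ge0 (a0 j x) (divr_ge0 S0 (N0 j))) w1.
  congr (_ <= _)%R.
    congr (_ `^ _)%R; apply: eq_bigr => j _.
    have [Nj|Nj] := eqVneq (N j) 0%R; first by rewrite Nj mul0r mul0r aN.
    have SN : S != 0%R.
      by rewrite gt_eqF// /S (bigD1 j)//= ltr_pwDl ?sumr_ge0// lt_def Nj N0.
    by field; rewrite Nj SN.
  apply: eq_bigr => j _.
  by rewrite powRM ?divr_ge0// /c; ring.
rewrite esum_sum => [|x j _ _]; last by rewrite mule_ge0// lee_fin ?powR_ge0.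
rewrite (eq_bigr (fun j => (c j)%:E * \esum_(x in F) (a j x `^ q)%:E)); last first.
  by move=> j _; rewrite esumZl// => x; rewrite lee_fin powR_ge0.
apply: (@le_trans _ _ (\sum_j ((c j)%:E * (N j `^ q)%:E))).
  by apply: lee_sum => j _; rewrite lee_wpmul2l ?lee_fin// -MN.
have -> : \sum_j ((c j)%:E * (N j `^ q)%:E) = (\sum_j c j * N j `^ q)%R%:E.
  by rewrite -sumEFin.
rewrite lee_fin.
have [SN|SN] := eqVneq S 0%R.
  rewrite big1 ?powR_ge0// => j _.
  by rewrite /c SN invr0 mulr0 mul0r mul0r.
rewrite (eq_bigr (fun j => N j / S * S `^ q))%R => [|j _].
  by rewrite -mulr_suml -mulr_suml divff// mul1r.
have [Nj|Nj] := eqVneq (N j) 0%R; first by rewrite /c Nj !mul0r.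
rewrite /c -mulrA -powRM ?divr_ge0//; congr (_ * _ `^ _)%R.
by field.
Qed.

Lemma minkowski_esum_le1 : (0 < q <= 1)%R ->
  (forall j, M j <= \esum_(x in F) (a j x `^ q)%:E) ->
  \sum_j M j `^ q^-1 <= (\esum_(x in F) ((\sum_j a j x) `^ q)%:E) `^ q^-1.
Proof.
move=> q01 aM; have /andP[q0 q1] := q01.
(* An infinite [M j] makes the sum of the [a j x ^ q] infinite, and this sum is dominated by that of
   the powers of [sum_j a j x]. *)
have [[j Mj]|Mfin] := pselect (exists j, M j = +oo).
  suff -> : \esum_(x in F) ((\sum_j a j x) `^ q)%:E = +oo.
    by rewrite poweRyr ?invr_eq0 ?gt_eqF// leey.
  apply/eqP; rewrite -leye_eq -Mj (le_trans (aM j))//.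
  apply: le_esum => x Fx; rewrite lee_fin.
  apply: ge0_ler_powR; rewrite ?nnegrE ?sumr_ge0 ?(ltW q0)//.
  by rewrite (bigD1 j)//= lerDl sumr_ge0.
pose N j := (fine (M j) `^ q^-1)%R.
have N0 j : (0 <= N j)%R by rewrite powR_ge0.
have MN j : M j = (N j `^ q)%:E.
  rewrite -powRrM mulVf ?gt_eqF// powRr1 ?fine_ge0// fineK//.
  by rewrite ge0_fin_numE// ltey; apply/eqP => Mj; apply: Mfin; exists j.
set S := (\sum_j N j)%R.
have S0 : (0 <= S)%R by exact: sumr_ge0.
have -> : \sum_j M j `^ q^-1 = S%:E.
  rewrite -sumEFin; apply: eq_bigr => j _.
  by rewrite MN poweR_EFin -powRrM mulfV ?gt_eqF// powRr1.
suff le : (S `^ q)%:E <= \esum_(x in F) ((\sum_j a j x) `^ q)%:E.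
  have -> : S%:E = (S `^ q)%:E `^ q^-1.
    by rewrite poweR_EFin -powRrM mulfV ?gt_eqF// powRr1.
  apply: gt0_ler_poweR => //; rewrite ?invr_ge0 ?ltW// in_itv/= leey andbT.
    by rewrite lee_fin powR_ge0.
  by rewrite esum_ge0// => x _; rewrite lee_fin powR_ge0.
pose c j := (N j / S * (S / N j) `^ q)%R.
have c0 j : (0 <= c j)%R by rewrite mulr_ge0 ?divr_ge0 ?powR_ge0.
apply: (@le_trans _ _
  (\esum_(x in F) \sum_j ((c j)%:E * (a j x `^ q)%:E))); last first.
  apply: le_esum => x Fx.
  have -> : \sum_j ((c j)%:E * (a j x `^ q)%:E) =
      (\sum_j c j * a j x `^ q)%R%:E by rewrite -sumEFin.
  rewrite lee_fin.
  have w1 : (\sum_j N j / S <= 1)%R.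
    by rewrite -mulr_suml -/S; have [->|/divff->//] := eqVneq S 0%R; rewrite mul0r.
  have := jensen_sum_le1 q01 (fun j => divr_ge0 (N0 j) S0)
    (fun j => mulr_ge0 (a0 j x) (divr_ge0 S0 (N0 j))) w1.
  have -> : (\sum_j c j * a j x `^ q =
      \sum_j N j / S * (a j x * (S / N j)) `^ q)%R.
    apply: eq_bigr => j _.
    by rewrite powRM ?divr_ge0// /c; ring.
  move=> /le_trans; apply; apply: ge0_ler_powR.
  - exact: ltW.
  - by rewrite nnegrE sumr_ge0// => j _; rewrite !mulr_ge0 ?invr_ge0.
  - by rewrite nnegrE sumr_ge0.
  (* Terms with [N j = 0] become 0 on the left because [0^-1 = 0]; the power is increasing, so the
     resulting inequality is in the right direction. *)
  apply: ler_sum => j _.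
  have [Nj|Nj] := eqVneq (N j) 0%R; first by rewrite Nj !mul0r.
  have [->|SN] := eqVneq S 0%R; first by rewrite invr0 mulr0 mul0r.
  rewrite le_eqVlt; apply/orP; left; apply/eqP.
  by field; rewrite Nj SN.
rewrite esum_sum => [|x j _ _]; last by rewrite mule_ge0// lee_fin ?powR_ge0.
rewrite (eq_bigr (fun j => (c j)%:E * \esum_(x in F) (a j x `^ q)%:E)); last first.
  by move=> j _; rewrite esumZl// => x; rewrite lee_fin powR_ge0.
apply: (@le_trans _ _ (\sum_j ((c j)%:E * (N j `^ q)%:E))); last first.
  by apply: lee_sum => j _; rewrite lee_wpmul2l ?lee_fin// -MN.
have -> : \sum_j ((c j)%:E * (N j `^ q)%:E) = (\sum_j c j * N j `^ q)%R%:E.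
  by rewrite -sumEFin.
rewrite lee_fin.
have [->|SN] := eqVneq S 0%R.
  by rewrite powR0 ?gt_eqF// sumr_ge0// => j _; rewrite mulr_ge0 ?powR_ge0.
rewrite [leRHS](eq_bigr (fun j => N j / S * S `^ q))%R => [|j _].
  by rewrite -mulr_suml -mulr_suml divff// mul1r.
have [Nj|Nj] := eqVneq (N j) 0%R; first by rewrite /c Nj !mul0r.
rewrite /c -mulrA -powRM ?divr_ge0//; congr (_ * _ `^ _)%R.
by field.
Qed.

End minkowski.

End EsumComplements.

(** * Inner product calculus with real-valued squares *)

Section HilbertBasics.
Set Implicit Arguments.
Unset Strict Implicit.
Local Open Scope complex_scope.
Variables (R : realType) (H : completeNormedModType R[i]).
Variable ip : {dot H for Num.conj}.
Hypothesis hip : norm_from_dot ip.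
Implicit Types (x y z : H) (a b : R[i]).

Lemma le0_linear_bound (r K : R) : (forall e : R, 0 < e -> r <= K * e) -> r <= 0.
Proof.
move=> rK; rewrite leNgt; apply/negP => r0.
have K1 : 0 < `|K| + 1 by rewrite ltr_wpDl.
have := rK (r / (2 * (`|K| + 1))); rewrite divr_gt0 ?mulr_gt0// => /(_ isT).
apply/negP; rewrite -ltNge.
apply: (@le_lt_trans _ _ ((`|K| + 1) * (r / (2 * (`|K| + 1))))).
  rewrite ler_wpM2r//; first by rewrite divr_ge0 ?mulr_ge0 ?(ltW K1) ?(ltW r0).
  by rewrite (le_trans (ler_norm _))// lerDl.
have -> : (`|K| + 1) * (r / (2 * (`|K| + 1))) = r / 2 by field; rewrite gt_eqF.
lra.
Qed.

Lemma exists_vanishing_seq : exists2 d : nat -> R, (forall k, 0 < d k) &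
  forall e : R, 0 < e -> exists N, forall n, (N <= n)%N -> d n < e.
Proof.
exists (fun k => k.+1%:R^-1) => [k|e e0]; first by rewrite invr_gt0.
exists (Num.trunc e^-1) => n Nn.
rewrite invf_plt ?posrE//; apply: lt_le_trans (truncnS_gt _) _.
by rewrite ler_nat.
Qed.

(** Squared modulus and squared norm take values in [R]: this avoids square roots and the partial
    order of [R[i]]. *)
Definition sqabs a : R := complex.Re a ^+ 2 + complex.Im a ^+ 2.
Definition sqn x : R := complex.Re (ip x x).

Lemma sqabsE a : (sqabs a)%:C = `|a| ^+ 2.
Proof. exact: add_Re2_Im2. Qed.

Lemma sqabs_ge0 a : 0 <= sqabs a.
Proof. by rewrite addr_ge0 ?sqr_ge0. Qed.

Lemma sqabsM a b : sqabs (a * b) = sqabs a * sqabs b.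
Proof.
by apply: complexI; rewrite rmorphM /= !sqabsE normrM exprMn.
Qed.

Lemma sqabsC (r : R) : sqabs r%:C = r ^+ 2.
Proof. by rewrite /sqabs /= expr0n /= addr0. Qed.

Lemma sqabs_conj a : sqabs a^*%C = sqabs a.
Proof. by case: a => u v; rewrite /sqabs /= sqrrN. Qed.

Lemma sqabsN a : sqabs (- a) = sqabs a.
Proof. by case: a => u v; rewrite /sqabs /= !sqrrN. Qed.

Lemma sqabs0 : sqabs 0 = 0.
Proof. by rewrite /sqabs /= expr0n /= addr0. Qed.

Lemma sqabs_eq0 a : sqabs a = 0 -> a = 0.
Proof.
move=> a0; apply/eqP; rewrite -normr_eq0 -sqrf_eq0 -sqabsE a0.
by [] .
Qed.

Lemma sqabs_vanish a (K : R) : (forall e : R, 0 < e -> sqabs a <= K * e) -> a = 0.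
Proof.
move=> aK; apply/sqabs_eq0/eqP; rewrite eq_le sqabs_ge0 andbT.
exact: le0_linear_bound aK.
Qed.

Lemma mul_conjC a : a * a^*%C = (sqabs a)%:C.
Proof. by rewrite sqabsE sqr_normc. Qed.

Lemma sqabsD a b : sqabs (a + b) <= 2 * (sqabs a + sqabs b).
Proof.
case: a b => [u v] [u' v']; rewrite /sqabs /=.
have := sqr_ge0 (u - u'); have := sqr_ge0 (v - v'); lra.
Qed.

Lemma ipDl x y z : ip (x + y) z = ip x z + ip y z.
Proof. exact: linearDl. Qed.
Lemma ipBl x y z : ip (x - y) z = ip x z - ip y z.
Proof. exact: linearBl. Qed.
Lemma ipNl x z : ip (- x) z = - ip x z.
Proof. exact: linearNl. Qed.
Lemma ip0l z : ip 0 z = 0.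
Proof. exact: linear0l. Qed.
Lemma ipZl a x z : ip (a *: x) z = a * ip x z.
Proof. exact: linearZl_LR. Qed.
Lemma ip_suml (I : Type) (r : seq I) (f : I -> H) z :
  ip (\sum_(i <- r) f i) z = \sum_(i <- r) ip (f i) z.
Proof. exact: linear_sumlz. Qed.
Lemma ipC x y : ip x y = (ip y x)^*%C.
Proof. by rewrite hermC /= expr0 mul1r. Qed.
Lemma ipDr x y z : ip z (x + y) = ip z x + ip z y.
Proof. exact: linearDr. Qed.
Lemma ipBr x y z : ip z (x - y) = ip z x - ip z y.
Proof. exact: linearBr. Qed.
Lemma ipNr x z : ip z (- x) = - ip z x.
Proof. exact: linearNr. Qed.
Lemma ip0r z : ip z 0 = 0.
Proof. exact: linear0r. Qed.
Lemma ipZr a x z : ip z (a *: x) = a^*%C * ip z x.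
Proof. exact: linearZr_LR. Qed.

Lemma sqnE x : ip x x = (sqn x)%:C.
Proof. by rewrite /sqn RRe_real// ger0_real// dnorm_ge0. Qed.

Lemma norm_sqn x : `|x| ^+ 2 = (sqn x)%:C.
Proof. by rewrite hip sqnE. Qed.

Lemma sqn_ge0 x : 0 <= sqn x.
Proof. by rewrite -lecR -sqnE dnorm_ge0. Qed.

Lemma sqn_eq0 x : sqn x = 0 -> x = 0.
Proof.
by move=> x0; apply/eqP; rewrite -(dnorm_eq0 ip) sqnE x0.
Qed.

Lemma sqn0 : sqn 0 = 0. Proof. by rewrite /sqn ip0l. Qed.

Lemma sqnZ a x : sqn (a *: x) = sqabs a * sqn x.
Proof.
by apply: complexI; rewrite -sqnE ipZl ipZr mulrA mul_conjC sqnE rmorphM.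
Qed.

Lemma ReC a : complex.Re a^*%C = complex.Re a. Proof. by case: a. Qed.

Lemma sqnDE x y : sqn (x + y) = sqn x + sqn y + 2 * complex.Re (ip x y).
Proof.
rewrite /sqn ipDl !ipDr (ipC y x) !raddfD /= ReC; ring.
Qed.

Lemma sqnN x : sqn (- x) = sqn x.
Proof. by rewrite -scaleN1r sqnZ /sqabs /=; ring. Qed.

Lemma sqnBC x y : sqn (x - y) = sqn (y - x).
Proof. by rewrite -sqnN opprB. Qed.

Lemma sqnBE x y : sqn (x - y) = sqn x + sqn y - 2 * complex.Re (ip x y).
Proof. by rewrite sqnDE sqnN ipNr raddfN /=; ring. Qed.

Lemma sqnD x y : sqn (x + y) <= 2 * (sqn x + sqn y).
Proof.
have := sqn_ge0 (x - y); rewrite sqnBE sqnDE; lra.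
Qed.

Lemma cauchy_schwarz x y : sqabs (ip x y) <= sqn x * sqn y.
Proof.
have [->|y0] := eqVneq y 0; first by rewrite ip0r sqabs0 sqn0 mulr0.
have ny : 0 < sqn y.
  by rewrite lt_def sqn_ge0 andbT; apply: contra_neq y0 => /sqn_eq0.
(* This square expands to [sqn y * (sqn x * sqn y - sqabs (ip x y))]. *)
have := sqn_ge0 ((sqn y)%:C *: x - ip x y *: y); rewrite sqnBE !sqnZ.
have -> : ip ((sqn y)%:C *: x) (ip x y *: y) = (sqn y * sqabs (ip x y))%:C.
  by rewrite ipZl ipZr [_^*%C * _]mulrC mul_conjC rmorphM.
rewrite /= sqabsC => h; rewrite -subr_ge0 -(pmulr_rge0 _ ny).
by move: h; congr (0 <= _); ring.
Qed.

Lemma norm_lt_sqn x (e : R) : 0 < e -> (`|x| < e%:C) = (sqn x < e ^+ 2).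
Proof.
move=> e0; rewrite -(@ltr_pXn2r _ 2) ?nnegrE ?ler0c ?(ltW e0)//.
by rewrite norm_sqn -rmorphXn ltcR.
Qed.

End HilbertBasics.

(** * Boundedness, completeness and compactness in terms of squared norms *)

Section HilbertTopology.
Set Implicit Arguments.
Unset Strict Implicit.
Local Open Scope complex_scope.
Variables (R : realType) (H : completeNormedModType R[i]).
Variable ip : {dot H for Num.conj}.
Hypothesis hip : norm_from_dot ip.
Local Notation sqn := (sqn ip).
Implicit Types (x y z : H) (a b : R[i]) (T : H -> H).

Lemma complex_gt0P a : 0 < a -> exists2 r : R, 0 < r & a = r%:C.
Proof.
move=> a0; exists (complex.Re a); last by rewrite RRe_real// ger0_real// ltW.
by rewrite -ltcR RRe_real// ger0_real// ltW.
Qed.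

Definition sq_bounded T := exists2 C : R, 0 <= C & forall x, sqn (T x) <= C * sqn x.

Lemma linearE T : linear T ->
  [/\ T 0 = 0, forall x y, T (x + y) = T x + T y,
      forall x y, T (x - y) = T x - T y & forall a x, T (a *: x) = a *: T x].
Proof.
move=> lT; have T0 : T 0 = 0.
  have := lT 1 0 0; rewrite !scale1r addr0 => /eqP.
  by rewrite -[X in X == _]addr0 (inj_eq (addrI _)) eq_sym => /eqP.
have TD x y : T (x + y) = T x + T y by have := lT 1 x y; rewrite !scale1r.
have TZ a x : T (a *: x) = a *: T x by have := lT a x 0; rewrite !addr0 T0 addr0.
by split=> // x y; rewrite TD -scaleN1r TZ scaleN1r.
Qed.

Lemma linear_sumE T (I : Type) (r : seq I) (f : I -> H) : linear T ->
  T (\sum_(i <- r) f i) = \sum_(i <- r) T (f i).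
Proof.
move=> /linearE[T0 TD _ _]; elim: r => [|i r IH]; first by rewrite !big_nil.
by rewrite !big_cons TD IH.
Qed.

Lemma bounded_opP T : bounded_op T <-> linear T /\ sq_bounded T.
Proof.
split=> -[lT]; have [T0 TD TB TZ] := linearE lT.
- move=> cT; split=> //.
  have /cvgrPdist_lt/(_ 1 ltr01) := cT 0.
  rewrite T0 => /nbhs_normP[_ /= /complex_gt0P[d d0 ->]] dT.
  exists (4 / d ^+ 2) => [|x]; first by rewrite divr_ge0 ?sqr_ge0.
  have := sqn_ge0 ip x; rewrite le_eqVlt => /predU1P[/esym/sqn_eq0 ->|n0].
    by rewrite T0 sqn0 mulr0.
  (* Scaling by [r] brings [x] to norm [d / 2], strictly inside the ball where [T] has norm below 1;
     this is the origin of the constant [4 / d ^ 2]. *)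
  pose r := d / 2 / Num.sqrt (sqn x).
  have r2 : r ^+ 2 = d ^+ 2 / 4 / sqn x.
    rewrite !exprMn !exprVn sqr_sqrtr ?(ltW n0)//; field.
    by rewrite gt_eqF.
  have := dT (r%:C *: x); rewrite /= !sub0r !normrN TZ.
  rewrite -[1]/(1%:C) !(norm_lt_sqn hip)//.
  rewrite !sqnZ !sqabsC r2 expr1n.
  have -> : d ^+ 2 / 4 / sqn x * sqn x = d ^+ 2 / 4 by field; rewrite gt_eqF.
  have d2 : 0 < d ^+ 2 by rewrite exprn_gt0.
  move=> /(_ ltac:(lra)) h.
  have -> : 4 / d ^+ 2 * sqn x = (d ^+ 2 / 4 / sqn x)^-1.
    by field; rewrite !gt_eqF.
  rewrite -[leRHS]mul1r ler_pdivlMr; last by rewrite !divr_gt0.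
  by rewrite mulrC ltW.
- move=> [C C0 TC]; split=> // x.
  apply/cvgrPdist_lt => _ /complex_gt0P[e e0 ->].
  have C1 : 0 < Num.sqrt (C + 1) by rewrite sqrtr_gt0; lra.
  apply/nbhs_normP; exists (e / Num.sqrt (C + 1))%:C.
    by rewrite /= ltcR divr_gt0.
  move=> y /=; rewrite !(norm_lt_sqn hip) ?divr_gt0// -TB => h.
  apply: le_lt_trans (TC _) _.
  apply: (@le_lt_trans _ _ ((C + 1) * sqn (x - y))).
    by rewrite ler_wpM2r ?sqn_ge0//; lra.
  move: h; rewrite expr_div_n sqr_sqrtr; last lra.
  by rewrite ltr_pdivlMr 1?mulrC//; lra.
Qed.

Lemma sqn_complete (u : nat -> H) :
  (forall e : R, 0 < e -> exists N, forall m n, (N <= m)%N -> (N <= n)%N ->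
    sqn (u m - u n) < e) ->
  exists l, forall e : R, 0 < e -> exists N, forall n, (N <= n)%N ->
    sqn (l - u n) < e.
Proof.
move=> cu; have /cvg_ex[l ul] : cvgn u.
  apply: cauchy_cvg; apply: cauchy_exP => _ /complex_gt0P[e e0 ->].
  have [N uN] := cu (e ^+ 2) (exprn_gt0 _ e0).
  exists (u N); exists N => // n /= Nn.
  by rewrite -ball_normE /= (norm_lt_sqn hip)// uN.
exists l => e e0; move/cvgrPdist_lt : ul => /(_ (Num.sqrt e)%:C).
rewrite ltcR sqrtr_gt0 => /(_ e0)[N _ uN]; exists N => n Nn.
by have := uN n Nn; rewrite /= (norm_lt_sqn hip) ?sqrtr_gt0// sqr_sqrtr// ltW.
Qed.

(** Compactness as existence of a cluster point for the images of a sequence in the unit ball; sums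
    and compositions are then handled by a choice of indices instead of closures. *)
Definition seq_compact T := forall u : nat -> H, (forall n, sqn (u n) <= 1) ->
  exists y, forall (e : R) N, 0 < e ->
    exists2 n, (N <= n)%N & sqn (T (u n) - y) < e.

Lemma compact_op_seq T : compact_op T -> seq_compact T.
Proof.
move=> [_ cT] u u1.
have [] := cT ((T \o u) @ \oo) _.
  exists 0%N => // n _; apply: subset_closure; exists (u n) => //=.
  by rewrite -(@ler_pXn2r _ 2)// ?nnegrE// expr1n (norm_sqn hip) -[1]/(1%:C) lecR.
move=> y [_ yc]; exists y => e N e0.
have [||z []] := yc [set z | exists2 n, (N <= n)%N & z = T (u n)]
    [set z | sqn (y - z) < e].
- by exists N => // n /= Nn; exists n.
- apply/nbhs_normP; exists (Num.sqrt e)%:C; first by rewrite /= ltcR sqrtr_gt0.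
  by move=> z /=; rewrite (norm_lt_sqn hip) ?sqrtr_gt0// sqr_sqrtr// ltW.
by move=> [n Nn ->] /= h; exists n => //; rewrite sqnBC.
Qed.

End HilbertTopology.

(** * Orthonormal series, Riesz-Fischer and Parseval *)

Section Orthonormal.
Set Implicit Arguments.
Unset Strict Implicit.
Local Open Scope complex_scope.
Variables (R : realType) (H : completeNormedModType R[i]).
Variable ip : {dot H for Num.conj}.
Hypothesis hip : norm_from_dot ip.
Local Notation sqn := (sqn ip).
Implicit Types (x y z e : H) (T : H -> H) (E : set H) (s : seq H) (c : H -> R[i]).

Definition orthonormal_set E : Prop :=
  (forall e, E e -> ip e e = 1) /\
  (forall e f, E e -> E f -> e <> f -> ip e f = 0).

Definition uniq_sub E s : Prop := uniq s /\ (forall e, e \in s -> E e).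

Lemma uniq_subU E s t : uniq_sub E s -> uniq_sub E t ->
  uniq_sub E (undup (s ++ t)).
Proof.
move=> [_ sE] [_ tE]; split; first exact: undup_uniq.
by move=> e; rewrite mem_undup mem_cat => /orP[/sE|/tE].
Qed.

Lemma seq_le_esum E s (a : H -> R) : (forall e, 0 <= a e) -> uniq_sub E s ->
  ((\sum_(e <- s) a e)%:E <= \esum_(e in E) (a e)%:E)%E.
Proof.
move=> a0 [us sE]; apply: esum_ge; exists [set` s]; last first.
  by rewrite -fsbig_seq// sumEFin.
by split => [|e /= /sE//]; exact: finite_seq.
Qed.

Lemma ler_sum_uniq s t (a : H -> R) : (forall e, 0 <= a e) -> uniq s -> uniq t ->
  {subset s <= t} -> \sum_(e <- s) a e <= \sum_(e <- t) a e.
Proof.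
move=> a0 us ut st; rewrite -lee_fin.
have sub : uniq_sub [set` t] s by split.
apply: le_trans (seq_le_esum a0 sub) _.
rewrite (esum_fset (finite_seq t)); last first.
  by move=> e _; rewrite lee_fin.
by rewrite -fsbig_seq// sumEFin.
Qed.

Lemma esum_le_seq E (a : H -> R) (M : \bar R) :
  (forall s, uniq_sub E s -> ((\sum_(e <- s) a e)%:E <= M)%E) ->
  (\esum_(e in E) (a e)%:E <= M)%E.
Proof.
move=> aM; apply: ge_ereal_sup => /= _ [X [finX XE] <-].
rewrite fsbig_finite//= sumEFin; apply: aM; split; first exact: finmap.fset_uniq.
by move=> e; rewrite in_fset_set// inE => /XE.
Qed.

Section fixed_set.
Variable E : set H.
Hypothesis oE : orthonormal_set E.

Lemma sqn_orthonormal e : E e -> sqn e = 1.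
Proof. by move=> Ee; apply: complexI; rewrite -sqnE (proj1 oE). Qed.

Lemma ip_comb s c e : uniq_sub E s -> E e ->
  ip (\sum_(f <- s) c f *: f) e = if e \in s then c e else 0.
Proof.
move=> [us sE] Ee; have [n1 o] := oE; rewrite ip_suml.
have zero f : E f -> f != e -> ip (c f *: f) e = 0.
  by move=> Ef /eqP fe; rewrite ipZl o// mulr0.
case: ifPn => es.
  rewrite (bigD1_seq e)//= ipZl n1// mulr1 big_seq_cond big1 ?addr0// => f.
  by move=> /andP[/sE]; exact: zero.
rewrite big_seq big1// => f fs; apply: zero; first exact: sE.
by apply: contraNneq es => <-.
Qed.

Lemma sqn_comb s c : uniq_sub E s ->
  sqn (\sum_(f <- s) c f *: f) = \sum_(f <- s) sqabs (c f).
Proof.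
move=> sE; apply: complexI; rewrite -sqnE {1}ip_suml rmorph_sum /=.
rewrite big_seq [RHS]big_seq; apply: eq_bigr => f fs.
rewrite ipZl ipC ip_comb//; last exact: (proj2 sE).
by rewrite fs mul_conjC.
Qed.

Lemma sqn_combB s t c : uniq_sub E s -> uniq_sub E t -> {subset s <= t} ->
  sqn (\sum_(f <- t) c f *: f - \sum_(f <- s) c f *: f) =
  \sum_(f <- t) sqabs (c f) - \sum_(f <- s) sqabs (c f).
Proof.
move=> [us sE] [ut tE] st.
have pst : perm_eq t (s ++ [seq f <- t | f \notin s]).
  apply: uniq_perm => //.
    rewrite cat_uniq us filter_uniq// andbT -all_predC; apply/allP => f /=.
    by rewrite mem_filter => /andP[].
  move=> f; rewrite mem_cat mem_filter; case: (boolP (f \in s)) => //= /st ->//.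
rewrite !(perm_big _ pst) /= !big_cat /=.
rewrite [in LHS]addrAC [in RHS]addrAC !subrr !add0r sqn_comb//.
by split; [exact: filter_uniq|move=> e; rewrite mem_filter => /andP[_ /tE]].
Qed.

Lemma bessel_eq s x : uniq_sub E s ->
  sqn (x - \sum_(f <- s) ip x f *: f) = sqn x - \sum_(f <- s) sqabs (ip x f).
Proof.
move=> sE; rewrite sqnBE sqn_comb//.
suff -> : complex.Re (ip x (\sum_(f <- s) ip x f *: f)) =
   \sum_(f <- s) sqabs (ip x f) by ring.
rewrite ipC ReC ip_suml -[RHS]/(complex.Re ((\sum_(f <- s) sqabs (ip x f))%:C)).
congr complex.Re; rewrite rmorph_sum; apply: eq_bigr => f _.
by rewrite ipZl (ipC _ f) mul_conjC.
Qed.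

(** Convergence of the series along the directed family of finite subsets of [E], represented by
    duplicate-free lists; no enumeration of [E] enters. *)
Definition hsum c z := forall e : R, 0 < e -> exists2 s0, uniq_sub E s0 &
  forall s, uniq_sub E s -> {subset s0 <= s} ->
    sqn (z - \sum_(f <- s) c f *: f) < e.

Lemma hsum_coef c z e : hsum c z -> E e -> ip z e = c e.
Proof.
move=> cz Ee; apply/eqP; rewrite -subr_eq0; apply/eqP/sqabs_eq0.
apply/eqP; rewrite eq_le sqabs_ge0 andbT; apply/ler_addgt0Pr => d d0.
rewrite add0r; have [s0 s0E /(_ (undup (e :: s0)))] := cz d d0.
have sE : uniq_sub E (undup (e :: s0)).
  split; first exact: undup_uniq.
  by move=> f; rewrite mem_undup inE => /predU1P[->//|/(proj2 s0E)].
move=> /(_ sE); have es : e \in undup (e :: s0) by rewrite mem_undup mem_head.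
have ss : {subset s0 <= undup (e :: s0)}.
  by move=> f fs; rewrite mem_undup inE fs orbT.
move=> /(_ ss) => lt.
have := cauchy_schwarz ip (z - \sum_(f <- undup (e :: s0)) c f *: f) e.
rewrite ipBl ip_comb// es => h; apply: ltW; apply: le_lt_trans h _.
by rewrite (sqn_orthonormal Ee) mulr1.
Qed.

(** Choose finite sets [u k] whose sums of [sqabs (c f)] come within [d k] of the supremum. By
    Pythagoras, enlarging [u k] moves the partial sum by less than [d k] in squared norm, so the
    partial sums over the [u k] are Cauchy and their limit is the unordered sum. *)
Theorem riesz_fischer c (C : R) :
  (forall s, uniq_sub E s -> \sum_(f <- s) sqabs (c f) <= C) ->
  exists2 z, hsum c z & sqn z <= C.
Proof.
move=> bC.
pose A : set R := [set r | exists2 s, uniq_sub E s & r = \sum_(f <- s) sqabs (c f)].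
have nilE : uniq_sub E [::] by split.
have supA : has_sup A.
  split; first by exists 0; exists [::]; rewrite ?big_nil.
  by exists C => _ [s sE ->]; exact: bC.
have [d d0 arch] := @exists_vanishing_seq R.
have /choice[u uP] : forall k : nat, exists s, uniq_sub E s /\
    sup A - d k < \sum_(f <- s) sqabs (c f).
  move=> k.
  by have [_ [s sE ->] lt] := sup_adherent (d0 k) supA; exists s.
have leS s : uniq_sub E s -> \sum_(f <- s) sqabs (c f) <= sup A.
  by move=> sE; apply: (sup_upper_bound supA); exists s.
pose w s := \sum_(f <- s) c f *: f.
have close k s : uniq_sub E s -> {subset u k <= s} ->
    sqn (w s - w (u k)) < d k.
  move=> sE us; have [ukE lt] := uP k; rewrite sqn_combB//.
  rewrite ltrBlDr in lt; rewrite ltrBlDr addrC.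
  exact: le_lt_trans (leS s sE) lt.
have close2 m n : sqn (w (u m) - w (u n)) <= 2 * (d m + d n).
  pose s := undup (u m ++ u n).
  have sE : uniq_sub E s by apply: uniq_subU; [exact: (uP m).1|exact: (uP n).1].
  have -> : w (u m) - w (u n) = - (w s - w (u m)) + (w s - w (u n)).
    by rewrite opprB addrA subrK.
  apply: le_trans (sqnD _ _ _) _; rewrite sqnN.
  have := close m s sE; have := close n s sE.
  move=> /(_ (fun f h => ltac:(by rewrite mem_undup mem_cat h orbT))).
  move=> h1 /(_ (fun f h => ltac:(by rewrite mem_undup mem_cat h))).
  by move: h1; lra.
have [e e0|z zP] := @sqn_complete _ _ _ hip (fun k => w (u k)).
  have [|N Ne] := arch (e / 4); first lra.
  exists N => m n Nm Nn; apply: le_lt_trans (close2 m n) _.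
  by have := Ne m Nm; have := Ne n Nn; lra.
have hz : hsum c z.
  move=> e e0; have [|N1 N1P] := zP (e / 4); first lra.
  have [|N2 N2P] := arch (e / 4); first lra.
  pose k := maxn N1 N2; exists (u k); first exact: (uP k).1.
  move=> s sE us; rewrite -/(w s).
  have -> : z - w s = (z - w (u k)) + (w (u k) - w s) by rewrite addrA subrK.
  apply: le_lt_trans (sqnD _ _ _) _; rewrite (sqnBC _ _ (w s)).
  have := close k s sE us; have := N1P k (leq_maxl _ _).
  by have := N2P k (leq_maxr _ _); lra.
(* [bessel_eq] splits [sqn z] into the squared distance to a partial sum, below [e], and a sum of
   coefficients, at most [C]. *)
exists z => //; apply/ler_addgt0Pr => e e0.
have [s0 s0E /(_ s0 s0E (fun _ h => h))] := hz e e0.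
have coef f : f \in s0 -> ip z f = c f.
  by move=> /(proj2 s0E); exact: hsum_coef.
have -> : \sum_(f <- s0) c f *: f = \sum_(f <- s0) ip z f *: f.
  by rewrite big_seq [RHS]big_seq; apply: eq_bigr => f fs; rewrite coef.
rewrite bessel_eq//.
have -> : \sum_(f <- s0) sqabs (ip z f) = \sum_(f <- s0) sqabs (c f).
  by rewrite big_seq [RHS]big_seq; apply: eq_bigr => f fs; rewrite coef.
by have := bC s0 s0E; lra.
Qed.

Lemma bessel s x : uniq_sub E s -> \sum_(f <- s) sqabs (ip x f) <= sqn x.
Proof. by move=> sE; rewrite -subr_ge0 -bessel_eq// sqn_ge0. Qed.

End fixed_set.

Lemma basis_orthonormal E : orthonormal_basis ip E -> orthonormal_set E.
Proof. by case. Qed.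

Section fixed_basis.
Variable E : set H.
Hypothesis bE : orthonormal_basis ip E.

Lemma basis_inj x y : (forall e, E e -> ip x e = ip y e) -> x = y.
Proof.
move=> xy; apply/eqP; rewrite -subr_eq0; apply/eqP; have [_ _] := bE; apply.
by move=> e Ee; rewrite ipBl xy// subrr.
Qed.

(** Bessel's inequality makes the series converge; its sum has the same coefficients as [x], and
    maximality of the basis identifies the two. *)
Lemma fourier_series x : hsum E (ip x) x.
Proof.
have oE := basis_orthonormal bE.
have [z hz _] := riesz_fischer oE (fun s sE => bessel oE x sE).
have zx : z = x by apply: basis_inj => e Ee; rewrite (hsum_coef oE hz).
by rewrite -[X in hsum _ _ X]zx.
Qed.

Lemma parseval x : (\esum_(e in E) (sqabs (ip x e))%:E = (sqn x)%:E)%E.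
Proof.
have oE := basis_orthonormal bE.
apply/eqP; rewrite eq_le; apply/andP; split.
  by apply: esum_le_seq => s sE; rewrite lee_fin (bessel oE).
apply/lee_addgt0Pr => d d0.
have [s sE /(_ s sE (fun _ h => h))] := fourier_series x d0.
rewrite (bessel_eq oE)// => lt.
apply: (@le_trans _ _ ((\sum_(f <- s) sqabs (ip x f) + d)%:E)).
  by rewrite lee_fin; lra.
by rewrite EFinD leeD2r// seq_le_esum// => e; exact: sqabs_ge0.
Qed.

End fixed_basis.
End Orthonormal.

(** * Spectral theorem for compact positive operators *)

Section SpectralTheorem.
Set Implicit Arguments.
Unset Strict Implicit.
Local Open Scope complex_scope.
Variables (R : realType) (H : completeNormedModType R[i]).
Variable ip : {dot H for Num.conj}.
Hypothesis hip : norm_from_dot ip.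
Local Notation sqn := (sqn ip).
Implicit Types (x y z e : H) (E : set H).

Definition quad (X : H -> H) x : R := complex.Re (ip (X x) x).

Definition psd (X : H -> H) : Prop :=
  [/\ linear X, sq_bounded ip X, forall x y, ip (X x) y = ip x (X y)
    & forall x, 0 <= quad X x].

Variable X : H -> H.
Hypothesis pX : psd X.

Lemma psd_quadE x : ip (X x) x = (quad X x)%:C.
Proof.
have [_ _ sX _] := pX; rewrite /quad RRe_real//.
apply/Creal_ImP; rewrite -complexIm; apply/eqP.
have : ip (X x) x = (ip (X x) x)^*%C by rewrite {1}sX ipC.
case: (ip (X x) x) => u v /= [/eqP]; rewrite -addr_eq0 -mulr2n.
by rewrite mulrn_eq0 => /eqP ->.
Qed.

(** The form is nonnegative at [x - t b y] for every real [t], with [b = ip (X x) y]. The optimal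
    [t] is [1 / quad X y]; when [quad X y = 0] the bound is linear in [t] and arbitrarily large [t]
    force [b = 0]. *)
Lemma psd_cauchy_schwarz x y : sqabs (ip (X x) y) <= quad X x * quad X y.
Proof.
have [lX _ sX X0] := pX; have [_ _ XB XZ] := linearE lX.
set b := ip (X x) y.
have pos (t : R) : 0 <= quad X x - 2 * t * sqabs b + t ^+ 2 * sqabs b * quad X y.
  have := X0 (x - (t%:C * b) *: y); rewrite {1}/quad XB XZ ipBl !ipBr !ipZl !ipZr.
  rewrite -/b (_ : ip (X y) x = b^*%C); last by rewrite sX ipC.
  rewrite !psd_quadE.
  have -> : (t%:C * b)^*%C = t%:C * b^*%C.
    by rewrite rmorphM; congr (_ * _); exact: conjc_real.
  have -> : (quad X x)%:C - t%:C * b^*%C * b -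
      (t%:C * b * b^*%C - t%:C * b * (t%:C * b^*%C * (quad X y)%:C)) =
    (quad X x)%:C - 2 * t%:C * (b * b^*%C) +
      t%:C ^+ 2 * (b * b^*%C) * (quad X y)%:C.
    by ring.
  rewrite mul_conjC -(rmorph_nat (@real_complex R) 2) -rmorphXn -!rmorphM.
  by rewrite -rmorphB -rmorphD.
have := X0 y; rewrite le_eqVlt => /predU1P[y0|y0].
  rewrite -y0 mulr0; apply/ler_addgt0Pr => e e0; rewrite add0r.
  have := pos (quad X x / (2 * e)); rewrite -y0 mulr0 addr0.
  have := X0 x; rewrite le_eqVlt => /predU1P[x0|x0].
    have := pos 1; rewrite -y0 -x0; have := sqabs_ge0 b; lra.
  have -> : 2 * (quad X x / (2 * e)) * sqabs b = quad X x / e * sqabs b.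
    by field; rewrite gt_eqF.
  rewrite subr_ge0 -ler_pdivlMl ?divr_gt0// invf_div.
  by rewrite divfK ?gt_eqF.
have := pos (quad X y)^-1.
have -> : quad X x - 2 * (quad X y)^-1 * sqabs b +
   (quad X y)^-1 ^+ 2 * sqabs b * quad X y = quad X x - sqabs b / quad X y.
  by field; rewrite gt_eqF.
by rewrite subr_ge0 ler_pdivrMr.
Qed.

Definition orthogonal_to E x := forall e, E e -> ip x e = 0.

Definition eigenset E := orthonormal_set ip E /\
  forall e, E e -> exists2 t : R, 0 <= t & X e = t%:C *: e.

Lemma sqn_normalize x : x != 0 -> sqn ((Num.sqrt (sqn x))^-1%:C *: x) = 1.
Proof.
move=> x0; have n0 : 0 < sqn x.
  by rewrite lt_def sqn_ge0 andbT; apply: contra_neq x0 => /sqn_eq0.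
by rewrite sqnZ sqabsC exprVn sqr_sqrtr ?(ltW n0)// mulVf// gt_eqF.
Qed.

Hypothesis kX : seq_compact ip X.

(* With [l] the maximum of [<X x, x>] over the unit ball of the orthogonal
   complement of [E], Cauchy-Schwarz for the form of [X] gives
   [||X x - l x||^2 <= l (l - <X x, x>)] there, so a cluster point of [X u_n] for a
   maximizing sequence [u_n] is an eigenvector. *)
Lemma exists_eigenvector E x0 : eigenset E -> orthogonal_to E x0 -> x0 != 0 ->
  exists e, [/\ sqn e = 1, orthogonal_to E e &
    exists2 t : R, 0 <= t & X e = t%:C *: e].
Proof.
move=> [oE eE] x0M x0n; have [lX [C C0 bX] sX X0] := pX.
have [XX0 XD XB XZ] := linearE lX.
have MZ a x : orthogonal_to E x -> orthogonal_to E (a *: x).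
  by move=> xM e Ee; rewrite ipZl xM// mulr0.
have XM x : orthogonal_to E x -> orthogonal_to E (X x).
  move=> xM e Ee; have [t t0 Xe] := eE e Ee.
  by rewrite sX Xe ipZr xM// mulr0.
suff [y [t [yn yM t0 Xy]]] : exists y (t : R),
    [/\ y != 0, orthogonal_to E y, 0 <= t & X y = t%:C *: y].
  exists ((Num.sqrt (sqn y))^-1%:C *: y); split; [exact: sqn_normalize|exact: MZ|].
  by exists t => //; rewrite XZ Xy !scalerA mulrC.
(* If [X] vanishes on the complement, [x0] is an eigenvector for 0; otherwise some [x1] with
   [X x1 <> 0] will make the maximum [l] positive. *)
have [X0M|] := pselect (forall x, orthogonal_to E x -> X x = 0).
  by exists x0, 0; split => //; rewrite scale0r X0M.
move=> /existsNP[x1 /not_implyP[x1M /eqP Xx1]].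
pose A : set R :=
  [set r | exists2 x, orthogonal_to E x /\ sqn x <= 1 & r = quad X x].
have A0 : A 0.
  exists 0; last by rewrite /quad XX0 ip0l.
  by split; [move=> e _; rewrite ip0l|rewrite sqn0].
have ubA : has_sup A.
  split; first by exists 0.
  (* A nonnegative [r] with [r ^ 2 <= C] satisfies [2 * r <= r ^ 2 + 1 <= C + 1]. *)
  exists (C + 1) => _ [x [xM x1'] ->].
  have := cauchy_schwarz ip (X x) x; rewrite psd_quadE sqabsC => h.
  have h2 : quad X x ^+ 2 <= C.
    apply: le_trans h _; apply: (@le_trans _ _ (C * sqn x * sqn x)).
      by rewrite ler_wpM2r ?sqn_ge0.
    by rewrite -mulrA -[leRHS]mulr1 ler_wpM2l// mulr_ile1 ?sqn_ge0.
  by have := sqr_ge0 (quad X x - 1); rewrite sqrrB1; move: h2 (X0 x); nra.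
set l := sup A.
have l0 : 0 <= l by exact: sup_upper_bound.
have Xl x : orthogonal_to E x -> quad X x <= l * sqn x.
  move=> xM; have [->|xn] := eqVneq x 0; first by rewrite /quad XX0 ip0l sqn0 mulr0.
  have n0 : 0 < sqn x.
    by rewrite lt_def sqn_ge0 andbT; apply: contra_neq xn => /sqn_eq0.
  have : A (quad X ((Num.sqrt (sqn x))^-1%:C *: x)).
    by eexists; last reflexivity; rewrite sqn_normalize//; split => //; exact: MZ.
  move/(sup_upper_bound ubA); rewrite -/l {1}/quad XZ ipZl ipZr psd_quadE.
  rewrite conjc_real -!rmorphM /= mulrA -expr2 exprVn sqr_sqrtr ?(ltW n0)//.
  by rewrite mulrC ler_pdivrMr.
have sqX x : orthogonal_to E x -> sqn (X x) <= l * quad X x.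
  move=> xM; have := sqn_ge0 ip (X x); rewrite le_eqVlt => /predU1P[<-|n0].
    by rewrite mulr_ge0.
  have := psd_cauchy_schwarz x (X x); rewrite sqnE sqabsC => h.
  rewrite -(ler_pM2r n0) -expr2; apply: le_trans h _.
  by rewrite mulrAC [leRHS]mulrC ler_wpM2l// Xl//; exact: XM.
have lp : 0 < l.
  rewrite lt_def l0 andbT; apply: contraNneq Xx1 => l00.
  apply/eqP/(@sqn_eq0 _ _ ip)/eqP; rewrite eq_le sqn_ge0 andbT.
  by apply: le_trans (sqX _ x1M) _; rewrite l00 mul0r.
have [d d0 arch] := @exists_vanishing_seq R.
have /choice[u uP] : forall k, exists x,
    [/\ orthogonal_to E x, sqn x <= 1 & l - d k < quad X x].
  move=> k; have [_ [x [xM x1'] ->] lt] := sup_adherent (d0 k) ubA.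
  by exists x.
have Xul n : sqn (X (u n) - l%:C *: u n) <= l * d n.
  have [uM u1 lu] := uP n; rewrite sqnBE sqnZ ipZr psd_quadE sqabsC conjc_real.
  rewrite -rmorphM /=; have h := sqX _ uM.
  have h1 : l ^+ 2 * sqn (u n) <= l ^+ 2.
    by rewrite -[leRHS]mulr1 ler_wpM2l// sqr_ge0.
  have h2 : l * (l - d n) <= l * quad X (u n) by rewrite ler_wpM2l// ltW.
  move: h h1 h2; rewrite expr2; lra.
have [y yP] := kX (fun n => let: And3 _ h _ := uP n in h).
have appr (e : R) : 0 < e -> exists n, [/\ sqn (X (u n) - y) < e,
    sqn (X (u n) - l%:C *: u n) <= l * e & l - e < quad X (u n)].
  move=> e0; have [N Ne] := arch e e0; have [n Nn nP] := yP e N e0.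
  exists n; split=> //; have := Ne n Nn => de.
    by apply: le_trans (Xul n) _; rewrite ler_wpM2l// ltW.
  have [_ _] := uP n; lra.
exists y, l; split=> //.
(* If [y = 0], both [X u_n] and [X u_n - l u_n] are small, hence so is [l u_n]. But
   [l - e < quad X u_n <= l * sqn u_n] keeps [u_n] away from 0; together they give
   [l ^ 2 <= (3 * l + 2) * e]. *)
- apply/eqP => y0; suff : l ^+ 2 <= 0 by rewrite leNgt exprn_gt0.
  apply: (@le0_linear_bound _ _ (3 * l + 2)) => e e0.
  have [n [h1 h2 h3]] := appr e e0.
  have [uM _ _] := uP n; have h4 := Xl _ uM.
  rewrite y0 subr0 in h1.
  have h5 : sqn (l%:C *: u n) <= 2 * (sqn (X (u n)) + sqn (X (u n) - l%:C *: u n)).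
    have -> : l%:C *: u n = X (u n) - (X (u n) - l%:C *: u n) by rewrite subKr.
    by apply: le_trans (sqnD _ _ _) _; rewrite sqnN subKr.
  rewrite sqnZ sqabsC in h5.
  have h6 : l * (l - e) <= l * (l * sqn (u n)).
    by rewrite ler_wpM2l// (le_trans (ltW h3)).
  by move: h1 h2 h5 h6; rewrite expr2 mulrA; lra.
- move=> e Ee; apply/sqabs_eq0/eqP; rewrite eq_le sqabs_ge0 andbT.
  apply: (@le0_linear_bound _ _ 1) => d1 d10; rewrite mul1r.
  have [n [h1 _ _]] := appr d1 d10; have [uM _ _] := uP n.
  have := cauchy_schwarz ip (y - X (u n)) e.
  rewrite ipBl (XM _ uM)// subr0 (sqn_orthonormal oE Ee) mulr1 sqnBC => h.
  by rewrite (le_trans h)// ltW.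
- apply/eqP; rewrite -subr_eq0; apply/eqP/(@sqn_eq0 _ _ ip)/eqP.
  rewrite eq_le sqn_ge0 andbT.
  apply: (@le0_linear_bound _ _ (2 * C + 4 * (C * l + l ^+ 2))) => e e0.
  have [n [h1 h2 _]] := appr e e0.
  have -> : X y - l%:C *: y = X (y - X (u n)) +
     (X (X (u n) - l%:C *: u n) + l%:C *: (X (u n) - y)).
    by rewrite !XB XZ scalerBr !addrA !subrK.
  have s1 := sqnD ip (X (y - X (u n)))
     (X (X (u n) - l%:C *: u n) + l%:C *: (X (u n) - y)).
  have s2 := sqnD ip (X (X (u n) - l%:C *: u n)) (l%:C *: (X (u n) - y)).
  have b1 : sqn (X (y - X (u n))) <= C * e.
    by apply: le_trans (bX _) _; rewrite ler_wpM2l// sqnBC ltW.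
  have b2 : sqn (X (X (u n) - l%:C *: u n)) <= C * (l * e).
    by apply: le_trans (bX _) _; rewrite ler_wpM2l.
  have b3 : sqn (l%:C *: (X (u n) - y)) <= l ^+ 2 * e.
    by rewrite sqnZ sqabsC ler_wpM2l ?sqr_ge0// ltW.
  by move: s1 s2 b1 b2 b3; lra.
Qed.

(** Zorn's lemma yields a maximal orthonormal set of eigenvectors. A nonzero vector orthogonal to it
    would provide one more eigenvector, so the set is a basis. *)
Theorem spectral_theorem : exists2 E, orthonormal_basis ip E &
  forall e, E e -> X e = (quad X e)%:C *: e.
Proof.
have [F FE Ftot|E [eE maxE]] := @Zorn_bigcup H eigenset.
  split=> [|e [G FG Ge]]; last exact: (FE G FG).2.
  split=> [e [G FG Ge]|e f [G FG Ge] [G' FG' Gf] ef].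
    exact: (FE G FG).1.1.
  have [GG|GG] := Ftot G G' FG FG'.
    exact: (FE G' FG').1.2 (GG _ Ge) Gf ef.
  exact: (FE G FG).1.2 Ge (GG _ Gf) ef.
have [[n1 o] eig] := eE.
exists E; last first.
  move=> e Ee; have [t t0 Xe] := eig e Ee; rewrite Xe; congr (_%:C *: _).
  by rewrite /quad Xe ipZl n1// mulr1.
split=> // x xE; apply/eqP; apply: contrapT => /negP xn.
have [e [ne eM et]] := exists_eigenvector eE xE xn.
have ee : ip e e = 1 by rewrite sqnE ne.
have nEe : ~ E e.
  by move=> Ee; have := eM e Ee; rewrite ee => /eqP; rewrite oner_eq0.
apply: (maxE (E `|` [set e])).
  split; first by move=> f Ef; left.
  by move/(_ e (or_intror erefl)).
split; last by move=> f [/eig//|->].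
split=> [f [/n1//|->//]|f g [Ef|->] [Eg|->] fg//]; first exact: o.
  by rewrite ipC eM// conjc0.
exact: eM.
Qed.

End SpectralTheorem.

(** * Stability properties of compact operators *)

Section CompactOperators.
Set Implicit Arguments.
Unset Strict Implicit.
Local Open Scope complex_scope.
Variables (R : realType) (H : completeNormedModType R[i]).
Variable ip : {dot H for Num.conj}.
Hypothesis hip : norm_from_dot ip.
Local Notation sqn := (sqn ip).
Implicit Types (x y z : H) (S T : H -> H).

Definition seq_compact_op T : Prop :=
  [/\ linear T, sq_bounded ip T & seq_compact ip T].

Lemma compact_op_seq_compact T : compact_op T -> seq_compact_op T.
Proof.
move=> cT; have /(bounded_opP hip)[lT bT] := cT.1.
by split=> //; exact: compact_op_seq.
Qed.

Lemma seq_compact_op0 : seq_compact_op (0 : H -> H).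
Proof.
split.
- by move=> a x y; rewrite /= scaler0 addr0.
- by exists 0 => // x; rewrite mul0r sqn0.
- by move=> u _; exists 0 => e N e0; exists N => //; rewrite subr0 sqn0.
Qed.

(** Indices [v k] along which [S] converges with rate [d k] are fixed before the compactness of [T]
    is applied to [u \o v], so that both cluster points are approached at the same indices. *)
Lemma seq_compact_opD S T : seq_compact_op S -> seq_compact_op T ->
  seq_compact_op (S + T).
Proof.
move=> [lS [C C0 bS] cS] [lT [D D0 bT] cT]; split.
- move=> a x y; have [_ SD _ SZ] := linearE lS; have [_ TD _ TZ] := linearE lT.
  by rewrite /= [LHS]/(S _ + T _) SD TD SZ TZ scalerDr addrACA.
- exists (2 * (C + D)) => [|x]; first by rewrite mulr_ge0 ?addr_ge0.
  apply: le_trans (sqnD _ _ _) _.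
  by have := bS x; have := bT x; lra.
- move=> u u1; have [y yP] := cS u u1.
  have [d d0 arch] := @exists_vanishing_seq R.
  have /choice[v vP] : forall k, exists n, (k <= n)%N /\ sqn (S (u n) - y) < d k.
    by move=> k; have [n kn ny] := yP (d k) k (d0 k); exists n.
  have [z zP] := cT (u \o v) (fun n => u1 (v n)).
  exists (y + z) => e N e0; have [|M Md] := arch (e / 4); first by lra.
  have [|n Nn nz] := zP (e / 4) (maxn M N); first by lra.
  exists (v n).
    by apply: leq_trans (vP n).1; apply: leq_trans Nn; exact: leq_maxr.
  have -> : (S + T) (u (v n)) - (y + z) = (S (u (v n)) - y) + (T (u (v n)) - z).
    by rewrite [(S + T) _]/(S _ + T _) opprD addrACA.
  apply: le_lt_trans (sqnD _ _ _) _.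
  have := (vP n).2; have := Md n (leq_trans (leq_maxl _ _) Nn).
  by move: nz => /=; lra.
Qed.

Lemma seq_compact_op_comp S T : linear S -> sq_bounded ip S ->
  seq_compact_op T -> seq_compact_op (S \o T).
Proof.
move=> lS [C C0 bS] [lT [D D0 bT] cT]; have [_ _ SB _] := linearE lS.
split.
- move=> a x y /=; have [_ SD _ SZ] := linearE lS.
  by have [_ TD _ TZ] := linearE lT; rewrite TD TZ SD SZ.
- exists (C * D) => [|x /=]; first exact: mulr_ge0.
  by apply: le_trans (bS _) _; rewrite -mulrA ler_wpM2l.
- move=> u u1; have [y yP] := cT u u1; exists (S y) => e N e0.
  have [|n Nn ny] := yP (e / (C + 1)) N; first by rewrite divr_gt0// ltr_wpDl.
  exists n => //=; rewrite -SB; apply: le_lt_trans (bS _) _.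
  apply: (@le_lt_trans _ _ ((C + 1) * sqn (T (u n) - y))).
    by rewrite ler_wpM2r ?sqn_ge0// lerDl.
  by move: ny; rewrite ltr_pdivlMr ?ltr_wpDl// mulrC.
Qed.

Lemma seq_compact_opZ (a : R[i]) T : seq_compact_op T -> seq_compact_op (a *: T).
Proof.
move=> cT; apply: (@seq_compact_op_comp ( *:%R a) T) => //.
  by move=> b x y; rewrite scalerDr !scalerA mulrC.
by exists (sqabs a) => [|x]; rewrite ?sqabs_ge0// sqnZ.
Qed.

Lemma seq_compact_opB S T : seq_compact_op S -> seq_compact_op T ->
  seq_compact_op (S - T).
Proof.
by move=> cS cT; rewrite -[- T]scaleN1r; apply/seq_compact_opD/seq_compact_opZ.
Qed.

Lemma seq_compact_op_sum (J : finType) (T : J -> H -> H) :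
  (forall j, seq_compact_op (T j)) -> seq_compact_op (\sum_j T j).
Proof.
move=> cT; elim/big_ind : _ => //; first exact: seq_compact_op0.
exact: seq_compact_opD.
Qed.

End CompactOperators.

(** * Existence of bases, Riesz representation and adjoints *)

Section Adjoint.
Set Implicit Arguments.
Unset Strict Implicit.
Local Open Scope complex_scope.
Variables (R : realType) (H : completeNormedModType R[i]).
Variable ip : {dot H for Num.conj}.
Hypothesis hip : norm_from_dot ip.
Local Notation sqn := (sqn ip).
Implicit Types (x y z e : H) (E : set H) (A B T : H -> H).

(** Every vector is an eigenvector of the zero operator, so the spectral theorem for [0] yields a
    basis. *)
Lemma exists_orthonormal_basis : exists E, orthonormal_basis ip E.
Proof.
have [l0 b0 c0] := seq_compact_op0 ip.
have [|E bE _] := @spectral_theorem _ _ ip 0 _ c0; last by exists E.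
by split=> // [x y|x]; rewrite /quad ?ip0l ?ip0r.
Qed.

(** Testing [f] on [sum_e c e *: e] with [c e] the conjugate of [f e] gives [r ^ 2 <= C * r] for the
    finite sum [r] of the [sqabs (c e)], so Riesz-Fischer produces [z]. Finite Fourier sums carry
    the identity over to all [x]. *)
Lemma riesz_representation (f : H -> R[i]) (C : R) : scalar f -> 0 <= C ->
  (forall x, sqabs (f x) <= C * sqn x) -> exists z, forall x, f x = ip x z.
Proof.
move=> lf C0 bf; have [E bE] := exists_orthonormal_basis.
have oE := basis_orthonormal bE.
have f0 : f 0 = 0.
  by apply/sqabs_eq0/eqP; rewrite eq_le sqabs_ge0 (le_trans (bf _))// sqn0 mulr0.
have fD x y : f (x + y) = f x + f y by have := lf 1 x y; rewrite scale1r mul1r.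
have fZ a x : f (a *: x) = a * f x by have := lf a x 0; rewrite !addr0 f0 addr0.
have fs (s : seq H) (c : H -> R[i]) :
    f (\sum_(e <- s) c e *: e) = \sum_(e <- s) c e * f e.
  by elim: s => [|e s IH]; rewrite ?big_nil// !big_cons fD fZ IH.
pose c e := (f e)^*%C.
have [|z hz zC] := @riesz_fischer _ _ ip hip E oE c C.
  move=> s sE; set r := \sum_(e <- s) _.
  have r0 : 0 <= r by rewrite sumr_ge0// => e _; exact: sqabs_ge0.
  have := bf (\sum_(e <- s) c e *: e); rewrite (sqn_comb oE)// -/r fs.
  have -> : \sum_(e <- s) c e * f e = r%:C.
    rewrite rmorph_sum; apply: eq_bigr => e _.
    by rewrite mulrC mul_conjC sqabs_conj.
  rewrite sqabsC; move: r0; rewrite le_eqVlt => /predU1P[<-//|r0].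
  by rewrite expr2 ler_pM2r.
exists z => x; apply/eqP; rewrite -subr_eq0; apply/eqP.
apply: (@sqabs_vanish _ _ (2 * (C + sqn z))) => e e0.
have [s sE /(_ s sE (fun _ h => h))] := fourier_series hip bE x e0.
set v := \sum_(g <- s) _ => lt.
have -> : f x - ip x z = f (x - v) + - ip (x - v) z.
  have -> : f (x - v) = f x - f v by rewrite fD -scaleN1r fZ mulN1r.
  suff -> : f v = ip v z by rewrite ipBl; ring.
  rewrite fs ip_suml big_seq [RHS]big_seq; apply: eq_bigr => g gs.
  rewrite ipZl (ipC _ g z) (hsum_coef oE hz); last exact: (proj2 sE).
  by rewrite /c conjcK.
apply: le_trans (sqabsD _ _) _; rewrite sqabsN.
have := bf (x - v); have := cauchy_schwarz ip (x - v) z.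
have : C * sqn (x - v) <= C * e by rewrite ler_wpM2l// ltW.
have : sqn (x - v) * sqn z <= sqn z * e by rewrite mulrC ler_wpM2l ?sqn_ge0// ltW.
lra.
Qed.

Lemma exists_adjoint A : bounded_op A -> exists B, adjoint_of ip A B.
Proof.
move=> /(bounded_opP hip)[lA [C C0 bA]].
have [_ AD _ AZ] := linearE lA.
have /choice[B BP] : forall y, exists z, forall x, ip (A x) y = ip x z.
  move=> y; apply: (@riesz_representation (fun x => ip (A x) y) (C * sqn y)).
  - by move=> a u v; rewrite AD AZ ipDl ipZl.
  - by rewrite mulr_ge0 ?sqn_ge0.
  - move=> x; apply: le_trans (cauchy_schwarz _ _ _) _.
    by rewrite mulrAC ler_wpM2r ?sqn_ge0.
have inj y z : (forall x, ip x y = ip x z) -> y = z.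
  move=> yz; apply/eqP; rewrite -subr_eq0; apply/eqP/(@sqn_eq0 _ _ ip).
  by apply: complexI; rewrite -sqnE ipBr yz subrr.
exists B; split; last by move=> x y; exact: BP.
apply/(bounded_opP hip); split.
  by move=> a u v; apply: inj => x; rewrite -BP ipDr ipZr !BP ipDr ipZr.
exists C => // y; have := sqn_ge0 ip (B y); rewrite le_eqVlt => /predU1P[<-|n0].
  by rewrite mulr_ge0 ?sqn_ge0.
have := cauchy_schwarz ip (A (B y)) y; rewrite BP sqnE sqabsC => h.
rewrite -(ler_pM2r n0) -expr2; apply: le_trans h _.
by rewrite mulrAC ler_wpM2r ?sqn_ge0.
Qed.

Lemma adjointP A : bounded_op A -> adjoint_of ip A (adjoint ip A).
Proof. by move=> /exists_adjoint; exact: xgetPex. Qed.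

(** The bridge to quadratic forms: from here on, a member of the family enters the trace
    inequalities only through [sqn (A x)]. *)
Lemma gram_psd A : bounded_op A ->
  psd ip (adjoint ip A \o A) /\ forall x, quad ip (adjoint ip A \o A) x = sqn (A x).
Proof.
move=> bA; have [/(bounded_opP hip)[lB [D D0 bB]] BP] := adjointP bA.
have /(bounded_opP hip)[lA [C C0 hA]] := bA.
have [_ AD _ AZ] := linearE lA; have [_ BD _ BZ] := linearE lB.
have G x y : ip (adjoint ip A (A x)) y = ip (A x) (A y).
  by rewrite ipC -BP -ipC.
have q x : quad ip (adjoint ip A \o A) x = sqn (A x) by rewrite /quad /= G.
split=> //; split.
- by move=> a x y; rewrite /= AD AZ BD BZ.
- exists (D * C) => [|x /=]; first exact: mulr_ge0.
  by apply: le_trans (bB _) _; rewrite -mulrA ler_wpM2l.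
- by move=> x y; rewrite /= G BP.
- by move=> x; rewrite q sqn_ge0.
Qed.

(** Polarization: reality of the form at [x + y] and at [x + i y] determines the imaginary and real
    parts of [ip (T x) y] against those of [ip (T y) x]. *)
Lemma positive_op_psd T : positive_op ip T -> psd ip T.
Proof.
move=> [/(bounded_opP hip)[lT bT] T0]; have [_ TD _ TZ] := linearE lT.
split=> // [x y|x]; last first.
  by have := T0 x; rewrite lecE => /andP[].
have im x' : complex.Im (ip (T x') x') = 0 by exact: ger0_Im.
rewrite [RHS]ipC; set b := ip (T x) y; set c := ip (T y) x.
have := im (x + y); rewrite TD ipDl !ipDr !raddfD /= !im -/b -/c add0r addr0 => h1.
have := im (x + 'i%C *: y); rewrite TD TZ ipDl !ipDr !ipZl !ipZr -/b -/c.
move: (im x) (im y) h1; case: b c => [b1 b2] [c1 c2].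
case: (ip (T x) x) (ip (T y) y) => [u1 u2] [v1 v2] /= *.
by apply/eqP; rewrite eq_complex /=; apply/andP; split; apply/eqP; lra.
Qed.

End Adjoint.

(** * Operators diagonal in an orthonormal basis *)

Section DiagonalOperators.
Set Implicit Arguments.
Unset Strict Implicit.
Local Open Scope complex_scope.
Variables (R : realType) (H : completeNormedModType R[i]).
Variable ip : {dot H for Num.conj}.
Hypothesis hip : norm_from_dot ip.
Local Notation sqn := (sqn ip).
Variable E : set H.
Hypothesis bE : orthonormal_basis ip E.
Implicit Types (x y z e : H) (T : H -> H).

(** [D x] is the sum of the series with coefficients [f e * ip x e]; Bessel's inequality bounds
    their squares by [C ^ 2 * sqn x]. *)
Lemma exists_diagonal_op (f : H -> R) (C : R) : 0 <= C ->
  (forall e, E e -> 0 <= f e <= C) ->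
  exists D, [/\ bounded_op D, forall e, E e -> D e = (f e)%:C *: e
    & forall x e, E e -> ip (D x) e = (f e)%:C * ip x e].
Proof.
move=> C0 fC; have oE := basis_orthonormal bE.
have /choice[D DP] : forall x, exists z,
    hsum ip E (fun e => (f e)%:C * ip x e) z /\ sqn z <= C ^+ 2 * sqn x.
  move=> x; have [|z hz zC] := @riesz_fischer _ _ ip hip E oE
    (fun e => (f e)%:C * ip x e) (C ^+ 2 * sqn x); last by exists z.
  move=> s sE; apply: le_trans (ler_wpM2l (sqr_ge0 C) (bessel oE x sE)).
  rewrite mulr_sumr big_seq [leRHS]big_seq; apply: ler_sum => e es.
  have /andP[f0 f1] := fC e (proj2 sE e es).
  by rewrite sqabsM sqabsC ler_wpM2r ?sqabs_ge0// ler_sqr ?nnegrE.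
have Dc x e : E e -> ip (D x) e = (f e)%:C * ip x e.
  by move=> Ee; rewrite (hsum_coef oE (DP x).1).
exists D; split=> //.
- apply/(bounded_opP hip); split.
    move=> a x y; apply: (basis_inj bE) => e Ee.
    by rewrite !ipDl !ipZl !Dc// ipDl ipZl; ring.
  by exists (C ^+ 2) => [|x]; [exact: sqr_ge0|exact: (DP x).2].
- move=> e Ee; apply: (basis_inj bE) => g Eg; rewrite Dc// ipZl.
  have [->//|/eqP ge] := eqVneq g e.
  by rewrite (proj2 oE e g)// ?mulr0// => eg; exact: ge.
Qed.

(** For a finite Fourier sum [v] of [x] the identity is finite algebra, and boundedness of [T]
    controls the error between [x] and [v]. The finite sums are real, so the form itself turns out
    to be real. *)
Lemma quad_diagonal T (t : H -> R) : bounded_op T -> (forall e, 0 <= t e) ->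
  (forall e, E e -> T e = (t e)%:C *: e) ->
  forall x, ip (T x) x = (quad ip T x)%:C /\
    (\esum_(e in E) (t e * sqabs (ip x e))%:E = (quad ip T x)%:E)%E.
Proof.
move=> /(bounded_opP hip)[lT [C C0 bT]] t0 Te x.
have oE := basis_orthonormal bE; have [_ TD TB TZ] := linearE lT.
pose S (s : seq H) := \sum_(e <- s) t e * sqabs (ip x e).
(* The error consists of two inner products of squared modulus at most [C * sqn x * d] each;
   [sqabsD] doubles their sum. *)
set K := 4 * C * sqn x.
have K0 : 0 <= K by rewrite !mulr_ge0 ?sqn_ge0.
have appr (d : R) : 0 < d -> exists2 s0, uniq_sub E s0 & forall s, uniq_sub E s ->
    {subset s0 <= s} -> sqabs (ip (T x) x - (S s)%:C) <= K * d.
  move=> d0; have [s0 s0E s0P] := fourier_series hip bE x d0.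
  exists s0 => // s sE ss; have := s0P s sE ss.
  set v := \sum_(g <- s) _ => lt.
  have vx : sqn v <= sqn x by rewrite (sqn_comb oE)// (bessel oE).
  have Tv : ip (T v) v = (S s)%:C.
    rewrite linear_sumE// ip_suml rmorph_sum /= big_seq [RHS]big_seq.
    apply: eq_bigr => g gs; have Eg := proj2 sE g gs.
    rewrite TZ Te// !ipZl (ipC _ g) (ip_comb oE)// gs.
    by rewrite rmorphM /= -mul_conjC; ring.
  have -> : ip (T x) x - (S s)%:C = ip (T (x - v)) x + ip (T v) (x - v).
    by rewrite TB ipBl ipBr -Tv; ring.
  apply: le_trans (sqabsD _ _) _.
  have h1 : sqabs (ip (T (x - v)) x) <= C * d * sqn x.
    apply: le_trans (cauchy_schwarz _ _ _) _; rewrite ler_wpM2r ?sqn_ge0//.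
    by apply: le_trans (bT _) _; rewrite ler_wpM2l// ltW.
  have h2 : sqabs (ip (T v) (x - v)) <= C * sqn x * d.
    apply: le_trans (cauchy_schwarz _ _ _) _.
    apply: ler_pM; rewrite ?sqn_ge0//; last exact: ltW.
    by apply: le_trans (bT _) _; rewrite ler_wpM2l.
  by rewrite /K; lra.
have im0 : ip (T x) x = (quad ip T x)%:C.
  have h : complex.Im (ip (T x) x) ^+ 2 = 0.
    apply/eqP; rewrite eq_le sqr_ge0 andbT.
    apply: (@le0_linear_bound _ _ K) => d d0; have [s sE sP] := appr d d0.
    apply: le_trans (sP s sE (fun _ h => h)).
    by case: (ip (T x) x) => u v; rewrite /sqabs /= oppr0 addr0 lerDr sqr_ge0.
  rewrite /quad; move/eqP: h; rewrite sqrf_eq0.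
  by case: (ip (T x) x) => u v /= /eqP ->.
split=> //.
have near (d : R) : 0 < d -> exists2 s0, uniq_sub E s0 & forall s, uniq_sub E s ->
    {subset s0 <= s} -> `|quad ip T x - S s| <= d.
  (* The squared error is at most [K * d ^ 2 / (K + 1)], hence at most [d ^ 2]; the added 1 covers
     [K = 0]. *)
  move=> d0; have [|s0 s0E s0P] := appr (d ^+ 2 / (K + 1)).
    by rewrite divr_gt0 ?exprn_gt0// ltr_wpDl.
  exists s0 => // s sE ss; have := s0P s sE ss.
  rewrite im0 -rmorphB sqabsC => h.
  rewrite -(@ler_pXn2r _ 2) ?nnegrE ?(ltW d0)// real_normK ?num_real//.
  apply: le_trans h _; rewrite mulrCA ler_piMr ?sqr_ge0//.
  by rewrite ler_pdivrMr ?ltr_wpDl// mul1r lerDl.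
have tc e : 0 <= t e * sqabs (ip x e) by rewrite mulr_ge0 ?sqabs_ge0.
apply/eqP; rewrite eq_le; apply/andP; split.
  apply: esum_le_seq => s sE; rewrite lee_fin.
  apply/ler_addgt0Pr => d d0; have [s0 s0E s0P] := near d d0.
  have usE := uniq_subU sE s0E.
  have h1 : S s <= S (undup (s ++ s0)).
    apply: ler_sum_uniq => //; [exact: sE.1|exact: usE.1|].
    by move=> g gs; rewrite mem_undup mem_cat gs.
  have := s0P _ usE (fun g h => ltac:(by rewrite mem_undup mem_cat h orbT)).
  by rewrite ler_norml => /andP[h2 _]; move: h1 h2; rewrite /S; lra.
apply/lee_addgt0Pr => d d0; have [s sE /(_ s sE (fun _ h => h))] := near d d0.
rewrite ler_norml => /andP[_ h]; apply: (@le_trans _ _ (S s + d)%:E).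
  by rewrite lee_fin; lra.
by rewrite EFinD leeD2r// seq_le_esum.
Qed.

End DiagonalOperators.

(** * Evaluation of the Schatten norm *)

Section SchattenNorm.
Set Implicit Arguments.
Unset Strict Implicit.
Local Open Scope complex_scope.
Variables (R : realType) (H : completeNormedModType R[i]).
Variable ip : {dot H for Num.conj}.
Hypothesis hip : norm_from_dot ip.
Local Notation sqn := (sqn ip).
Implicit Types (x y z e : H) (E : set H) (A B S T : H -> H).

(** Only the form [Q] is recorded and the operator is forgotten, so that a pointwise identity
    between forms is all that is needed to compare eigenvalues. *)
Definition diagonalizes E (s : H -> R) (Q : H -> R) : Prop :=
  [/\ orthonormal_basis ip E, forall e, 0 <= s e &
    forall x, (\esum_(e in E) (s e * sqabs (ip x e))%:E = (Q x)%:E)%E].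

Lemma sqabs_ipC x y : sqabs (ip x y) = sqabs (ip y x).
Proof. by rewrite ipC sqabs_conj. Qed.

Lemma psd_bounded T : psd ip T -> bounded_op T.
Proof. by move=> [lT bT _ _]; apply/(bounded_opP hip). Qed.

Lemma psd_diagonalizes T E : psd ip T -> orthonormal_basis ip E ->
  (forall e, E e -> T e = (quad ip T e)%:C *: e) ->
  diagonalizes E (quad ip T) (quad ip T).
Proof.
move=> pT bE Te; have [_ _ _ T0] := pT; split=> // x.
by have [] := quad_diagonal hip bE (psd_bounded pT) T0 Te x.
Qed.

Lemma quad_bounded T : psd ip T -> exists2 C, 0 <= C &
  forall e, sqn e = 1 -> quad ip T e <= C.
Proof.
move=> pT; have [_ [C C0 bT] _ T0] := pT; exists (C + 1); first by rewrite addr_ge0.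
move=> e e1; have := cauchy_schwarz ip (T e) e.
rewrite psd_quadE// sqabsC e1 mulr1 => h; have := bT e; rewrite e1 mulr1 => h'.
by have := sqr_ge0 (quad ip T e - 1); rewrite sqrrB1; move: h h' (T0 e); nra.
Qed.

(** Uniqueness of the positive square root, seen on eigenvectors. For [t > 0] the defect
    [z = T e - sqrt t e] satisfies [T z = - sqrt t z], and positivity of [T] leaves only [z = 0].
    This determines the chosen [op_abs] on an eigenbasis of its square. *)
Lemma positive_sqrt_eigen S T e (t : R) : positive_op ip T -> T \o T = S ->
  0 <= t -> S e = t%:C *: e -> T e = (Num.sqrt t)%:C *: e.
Proof.
move=> pT TS t0 Se; have pT' := positive_op_psd hip pT.
have [lT _ sT T0] := pT'; have [_ _ TB TZ] := linearE lT.
have TTe : T (T e) = t%:C *: e by rewrite -Se -TS.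
move: t0; rewrite le_eqVlt => /predU1P[t0|t0].
  rewrite -t0 sqrtr0 scale0r; apply: (@sqn_eq0 _ _ ip); apply: complexI.
  by rewrite -sqnE -sT TTe -t0 scale0r ip0l.
apply/eqP; rewrite -subr_eq0; apply/eqP; set z := T e - _.
have Tz : T z = - ((Num.sqrt t)%:C *: z).
  by rewrite /z TB TZ TTe scalerBr opprB scalerA -rmorphM /= -expr2 sqr_sqrtr// ltW.
have := T0 z; rewrite /quad Tz ipNl ipZl sqnE -rmorphM raddfN /= oppr_ge0.
have st0 : 0 < Num.sqrt t by rewrite sqrtr_gt0.
rewrite pmulr_rle0// => z0; apply: (@sqn_eq0 _ _ ip); apply/eqP.
by rewrite eq_le z0 sqn_ge0.
Qed.

Lemma op_absP A : bounded_op A -> seq_compact ip A ->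
  positive_op ip (op_abs ip A) /\ op_abs ip A \o op_abs ip A = adjoint ip A \o A.
Proof.
move=> bA cA; set S := _ \o A; have [pS qS] := gram_psd hip bA.
have [/(bounded_opP hip)[lA' bA'] _] := adjointP hip bA.
have /(bounded_opP hip)[lA hA] := bA.
have [lS bS sS S0] := pS.
have [_ _ cS] : seq_compact_op ip S by apply: seq_compact_op_comp.
have [E bE SE] := spectral_theorem pS cS.
have oE := basis_orthonormal bE.
have [C C0 SC] := quad_bounded pS.
suff : exists T, positive_op ip T /\ T \o T = S by exact: xgetPex.
have [|D [bD De Dc]] := @exists_diagonal_op _ _ _ hip _ bE
    (fun e => Num.sqrt (quad ip S e)) (Num.sqrt C) (sqrtr_ge0 _).
  by move=> e Ee; rewrite sqrtr_ge0 ler_wsqrtr// SC// (sqn_orthonormal oE Ee).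
exists D; split.
  split=> // x; have [-> h] := quad_diagonal hip bE bD (fun e => sqrtr_ge0 _) De x.
  rewrite ler0c -lee_fin -h esum_ge0// => e _.
  by rewrite lee_fin mulr_ge0 ?sqrtr_ge0 ?sqabs_ge0.
apply/funext => x; apply: (basis_inj bE) => e Ee.
rewrite [LHS]Dc// Dc// mulrA -rmorphM /= -expr2 sqr_sqrtr; last exact: S0.
rewrite /S sS SE// ipZr.
by congr (_ * _); rewrite conjc_real.
Qed.

Lemma op_powerP A (p : R) : bounded_op A -> seq_compact ip A -> 0 < p ->
  op_power_of ip (op_abs ip A) p (op_power ip (op_abs ip A) p).
Proof.
move=> bA cA p0; have [pT TS] := op_absP bA cA.
have [pS qS] := gram_psd hip bA.
have [/(bounded_opP hip)[lA' bA'] _] := adjointP hip bA.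
have /(bounded_opP hip)[lA hA] := bA.
have [_ _ cS] : seq_compact_op ip (adjoint ip A \o A) by apply: seq_compact_op_comp.
have [E bE SE] := spectral_theorem pS cS.
have oE := basis_orthonormal bE; have [_ _ _ S0] := pS.
have [C C0 SC] := quad_bounded pS.
pose s e := Num.sqrt (quad ip (adjoint ip A \o A) e).
suff : exists D, op_power_of ip (op_abs ip A) p D by exact: xgetPex.
have [|D [bD De _]] := @exists_diagonal_op _ _ _ hip _ bE
    (fun e => s e `^ p) (Num.sqrt C `^ p) (powR_ge0 _ _).
  move=> e Ee; rewrite powR_ge0 ge0_ler_powR ?nnegrE ?sqrtr_ge0 ?(ltW p0)//.
  by rewrite ler_wsqrtr// SC// (sqn_orthonormal oE Ee).
exists D; split=> //; exists E, s; split=> // e Ee; split.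
- exact: sqrtr_ge0.
- exact: positive_sqrt_eigen pT TS (S0 e) (SE e Ee).
- exact: De.
Qed.

(** Independence of the basis [F] chosen by the trace: each [ip (T x) x] is expanded in [E], the
    sums are exchanged, and Parseval in [F] gives every eigenvalue total weight 1. *)
Lemma op_trace_diagonal T E (t : H -> R) : orthonormal_basis ip E ->
  bounded_op T -> (forall e, 0 <= t e) -> (forall e, E e -> T e = (t e)%:C *: e) ->
  (op_trace ip T = \esum_(e in E) (t e)%:E)%E.
Proof.
move=> bE bT t0 Te; rewrite /op_trace; set F := xget _ _.
have bF : orthonormal_basis ip F.
  suff : exists E', orthonormal_basis ip E' by exact: xgetPex.
  by exists E.
rewrite [LHS](eq_esum
  (b := fun x => \esum_(e in E) (t e * sqabs (ip x e))%:E)%E); last first.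
  by move=> x _; have [_ ->] := quad_diagonal hip bE bT t0 Te x.
rewrite exchange_esum; last by move=> *; rewrite lee_fin mulr_ge0 ?sqabs_ge0.
apply: eq_esum => e Ee; under eq_esum do rewrite EFinM sqabs_ipC.
rewrite esumZl//; last by move=> x; rewrite lee_fin sqabs_ge0.
by rewrite (parseval hip bF) (sqn_orthonormal (basis_orthonormal bE) Ee) mule1.
Qed.

(** [E] comes from the chosen power of [op_abs]. The squares of the eigenvalues of [op_abs] are
    those of the Gram operator, whence the exponent [p / 2]. *)
Theorem schatten_normE A (p : R) : bounded_op A -> seq_compact ip A -> 0 < p ->
  exists E s, diagonalizes E s (fun x => sqn (A x)) /\
    (schatten_norm ip p A = (\esum_(e in E) (s e `^ (p / 2))%:E) `^ p^-1)%E.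
Proof.
move=> bA cA p0; have [pT TS] := op_absP bA cA.
have [bP [E [s [bE sE]]]] := op_powerP bA cA p0.
have [pS qS] := gram_psd hip bA.
have [lT _] := positive_op_psd hip pT; have [_ _ _ TZ] := linearE lT.
exists E, (fun e => s e ^+ 2); split.
  split=> // [e|x]; first exact: sqr_ge0.
  rewrite -qS; have [] // := quad_diagonal hip bE (psd_bounded pS)
    (fun e => sqr_ge0 (s e)) _ x.
  move=> e Ee; have [s0 Te _] := sE e Ee.
  by rewrite -TS /= Te TZ Te scalerA -rmorphM.
rewrite /schatten_norm; congr (_ `^ _)%E.
rewrite (op_trace_diagonal (t := fun e => s e `^ p) bE bP).
- apply: eq_esum => e Ee; have [s0 _ _] := sE e Ee.
  rewrite -powR_mulrn// -powRrM; congr (_ `^ _)%:E.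
  by field.
- by move=> e; exact: powR_ge0.
- by move=> e Ee; have [_ _ ->] := sE e Ee.
Qed.

End SchattenNorm.

(** * Trace inequalities for sums of positive forms *)

Section TraceInequalities.
Set Implicit Arguments.
Unset Strict Implicit.
Variables (R : realType) (H : completeNormedModType R[i]).
Variable ip : {dot H for Num.conj}.
Hypothesis hip : norm_from_dot ip.
Local Notation sqn := (sqn ip).
Implicit Types (x y e u v : H) (E F : set H).

Lemma diagonalizes_ge0 E s Q x : diagonalizes ip E s Q -> 0 <= Q x.
Proof.
move=> [_ s0 EQ]; rewrite -lee_fin -EQ esum_ge0// => e _.
by rewrite lee_fin mulr_ge0 ?sqabs_ge0.
Qed.

Lemma diagonalizes_eigen E s Q e : diagonalizes ip E s Q -> E e -> Q e = s e.
Proof.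
move=> [bE s0 EQ] Ee; have oE := basis_orthonormal bE.
apply: EFin_inj; rewrite -EQ.
rewrite (eq_esum (b := fun f => ((s e)%:E * (sqabs (ip e f))%:E)%E)); last first.
  move=> f Ef; rewrite -EFinM; have [->//|/eqP fe] := eqVneq f e.
  by rewrite (proj2 oE e f) ?sqabs0 ?mulr0// => ef; exact: fe.
rewrite esumZl// => [|f]; last by rewrite lee_fin sqabs_ge0.
by rewrite (parseval hip bE) (sqn_orthonormal oE Ee) mule1.
Qed.

Lemma diagonalizes_term E s Q e x : diagonalizes ip E s Q -> E e ->
  s e * sqabs (ip x e) <= Q x.
Proof.
move=> [bE s0 EQ] Ee; rewrite -lee_fin -EQ.
apply: (le_esum_term (a := fun e => (s e * sqabs (ip x e))%:E)) => // f.
by rewrite lee_fin mulr_ge0 ?sqabs_ge0.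
Qed.

Section peierls.
Local Open Scope ereal_scope.
Variables (E F : set H) (s : H -> R) (Q : H -> R) (q : R).
Hypotheses (EQ : diagonalizes ip E s Q) (bF : orthonormal_basis ip F).

Let oF := basis_orthonormal bF.

Let sumw u : F u -> \esum_(e in E) (sqabs (ip u e))%:E = 1.
Proof.
move=> Fu; have [bE _ _] := EQ.
by rewrite (parseval hip bE) (sqn_orthonormal oF Fu).
Qed.

Let sumw' e : E e -> \esum_(u in F) (sqabs (ip u e))%:E = 1.
Proof.
move=> Ee; have [bE _ _] := EQ; under eq_esum do rewrite sqabs_ipC.
by rewrite (parseval hip bF) (sqn_orthonormal (basis_orthonormal bE) Ee).
Qed.

Let sumwt u : \esum_(e in E) (sqabs (ip u e) * s e)%:E = (Q u)%:E.
Proof. by have [_ _ <-] := EQ; apply: eq_esum => e _; rewrite mulrC. Qed.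

(** Peierls' inequality: [Q u] is the average of the eigenvalues with weights [sqabs (ip u e)]. The
    basis [F] is unrelated to [Q]; it will be an eigenbasis of the sum. *)
Lemma peierls_ge1 : (1 <= q)%R ->
  \esum_(u in F) (Q u `^ q)%:E <= \esum_(e in E) (s e `^ q)%:E.
Proof.
move=> q1; have [_ s0 _] := EQ.
apply: (@majorization_ge1 R H H F E (fun u e => sqabs (ip u e)) Q s) => //.
- by move=> *; exact: sqabs_ge0.
- by move=> u Fu; rewrite sumw.
- by move=> e Ee; rewrite sumw'.
Qed.

Lemma peierls_le1 : (0 < q <= 1)%R ->
  \esum_(e in E) (s e `^ q)%:E <= \esum_(u in F) (Q u `^ q)%:E.
Proof.
move=> q1; have [_ s0 _] := EQ.
apply: (@majorization_le1 R H H F E (fun u e => sqabs (ip u e)) Q s) => //.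
- by move=> *; exact: sqabs_ge0.
- by move=> u Fu; rewrite sumw.
- by move=> e Ee _; rewrite sumw'.
Qed.

End peierls.

Section sum_of_forms.
Local Open Scope ereal_scope.
Variables (J : finType) (E : J -> set H) (s : J -> H -> R) (Q : J -> H -> R).
Variables (F : set H) (t : H -> R) (QF : H -> R) (q : R).
Hypothesis EQ : forall j, diagonalizes ip (E j) (s j) (Q j).
Hypothesis FQ : diagonalizes ip F t QF.
Hypothesis sumQ : forall x, (QF x = \sum_j Q j x)%R.

Let bF : orthonormal_basis ip F. Proof. by case: FQ. Qed.
Let oF := basis_orthonormal bF.
Let Q0 j x : (0 <= Q j x)%R. Proof. exact: diagonalizes_ge0 (EQ j). Qed.
Let t0 u : (0 <= t u)%R. Proof. by case: FQ. Qed.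
Let s0 j e : (0 <= s j e)%R. Proof. by case: (EQ j). Qed.

Let tE u : F u -> (t u = \sum_j Q j u)%R.
Proof. by move=> Fu; rewrite -sumQ (diagonalizes_eigen FQ Fu). Qed.

(** At an eigenvector [u] of the sum, [t u = sum_j Q j u]. Minkowski separates the indices [j], and
    Peierls bounds each diagonal sum by the corresponding trace. *)
Lemma schatten_triangle_ge1 : (1 <= q)%R ->
  (\esum_(u in F) (t u `^ q)%:E) `^ q^-1 <=
  \sum_j (\esum_(e in E j) (s j e `^ q)%:E) `^ q^-1.
Proof.
move=> q1; rewrite (eq_esum (b := fun u => ((\sum_j Q j u) `^ q)%:E)); last first.
  by move=> u /tE ->.
apply: minkowski_esum_ge1 => // [j|j].
  by rewrite esum_ge0// => e _; rewrite lee_fin powR_ge0.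
exact: peierls_ge1 (EQ j) bF q1.
Qed.

Lemma schatten_triangle_le1 : (0 < q <= 1)%R ->
  \sum_j (\esum_(e in E j) (s j e `^ q)%:E) `^ q^-1 <=
  (\esum_(u in F) (t u `^ q)%:E) `^ q^-1.
Proof.
move=> q1; rewrite [in leRHS](eq_esum
  (b := fun u => ((\sum_j Q j u) `^ q)%:E)); last first.
  by move=> u /tE ->.
apply: minkowski_esum_le1 => // [j|j].
  by rewrite esum_ge0// => e _; rewrite lee_fin powR_ge0.
exact: peierls_le1 (EQ j) bF q1.
Qed.

(* The weight of the eigenvector [e] of the [j]-th form at the eigenvector [u] of
   the sum; it is [0] when [t u = 0] since then [(t u)^-1 = 0]. *)
Let w (z : J * H) u : R := (s z.1 z.2 * sqabs (ip z.2 u) / t u)%R.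
Let A : set (J * H) := [set: J] `*`` E.

Let w0 z u : (0 <= w z u)%R.
Proof. by rewrite divr_ge0 ?mulr_ge0 ?sqabs_ge0. Qed.

Let esumA (f : J * H -> R) : (forall z, 0 <= f z)%R ->
  \esum_(z in A) (f z)%:E = \sum_j \esum_(e in E j) (f (j, e))%:E.
Proof.
move=> f0; rewrite -esum_fin => [|j]; last first.
  by rewrite esum_ge0// => e _; rewrite lee_fin.
rewrite esum_esum => [|j e _ _]; last by rewrite lee_fin.
by apply: eq_esum => -[].
Qed.

(* This is [<X^-1 e, e> <= 1 / s_j e], tested on [v], a finite truncation of
   [X^-1 e]. *)
Let sumw z : A z -> \esum_(u in F) (w z u)%:E <= 1.
Proof.
case: z => j e [_ /= Ee]; apply: esum_le_seq => r rF; rewrite lee_fin.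
pose c u : R[i] := ((t u)^-1%:C%C * ip e u)%R.
pose v := (\sum_(u <- r) c u *: u)%R.
pose K := (\sum_(u <- r) sqabs (ip e u) / t u)%R.
have K0 : (0 <= K)%R by rewrite sumr_ge0// => u _; rewrite divr_ge0 ?sqabs_ge0.
have -> : (\sum_(u <- r) w (j, e) u = s j e * K)%R.
  by rewrite mulr_sumr; apply: eq_bigr => u _; rewrite /w mulrA.
have ve : ip v e = K%:C%C.
  rewrite ip_suml rmorph_sum; apply: eq_bigr => u _.
  by rewrite ipZl (ipC _ u) -mulrA mul_conjC -rmorphM mulrC.
have QvK : (QF v <= K)%R.
  rewrite -lee_fin; have [_ _ <-] := FQ.
  rewrite (eq_esum (b := fun u =>
    if u \in [set` r] then (sqabs (ip e u) / t u)%:E else 0)).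
    rewrite -esum_mkcondr; have -> : F `&` [set` r] = [set` r].
      by apply/seteqP; split=> [u []//|u ur]; split=> //; exact: (proj2 rF).
    rewrite (esum_fset (finite_seq r)); last first.
      by move=> u _; rewrite lee_fin divr_ge0 ?sqabs_ge0.
    by rewrite -fsbig_seq ?sumEFin//; exact: rF.1.
  move=> u Fu; rewrite (ip_comb oF)// /c.
  have -> : (u \in [set` r]) = (u \in r) by apply/idP/idP; rewrite inE.
  case: ifP => _; last by rewrite sqabs0 mulr0.
  rewrite sqabsM sqabsC; congr (_%:E).
  by have [->|tu] := eqVneq (t u) 0%R; [rewrite invr0 mul0r mulr0|field].
(* Since [ip v e = K], the single term [s j e * K ^ 2] is at most [Q j v <= QF v <= K]; dividing by
   [K] gives the claim. *)
have : (s j e * K ^+ 2 <= K)%R.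
  apply: le_trans QvK; rewrite sumQ (bigD1 j)//=.
  have := diagonalizes_term v (EQ j) Ee; rewrite ve sqabsC => /le_trans; apply.
  by rewrite lerDl sumr_ge0.
move: K0; rewrite le_eqVlt => /predU1P[<- _|K0]; first by rewrite mulr0.
by rewrite expr2 mulrA ger_pMl.
Qed.

Let sumwt z : A z -> \esum_(u in F) (w z u * t u)%:E = (s z.1 z.2)%:E.
Proof.
case: z => j e [_ /= Ee].
rewrite (eq_esum (b := fun u => (s j e)%:E * (sqabs (ip e u))%:E)).
  rewrite esumZl// => [|u]; last by rewrite lee_fin sqabs_ge0.
  have [bE _ _] := EQ j.
  by rewrite (parseval hip bF) (sqn_orthonormal (basis_orthonormal bE) Ee) mule1.
move=> u Fu; rewrite -EFinM; congr (_%:E); rewrite /w /=.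
(* Division by a zero [t u] loses nothing: [s j e * sqabs (ip u e) <= Q j u <= t u = 0]. *)
have [tu|tu] := eqVneq (t u) 0%R; last by rewrite divfK.
rewrite tu mulr0; apply/esym/eqP; rewrite eq_le mulr_ge0 ?sqabs_ge0// andbT.
rewrite sqabs_ipC; apply: le_trans (diagonalizes_term u (EQ j) Ee) _.
by rewrite -tu tE// (bigD1 j)//= lerDl sumr_ge0.
Qed.

(** Summing over [e] turns the weights into [Q j u / t u], and summing over [j] gives
    [t u / t u]. *)
Let sumw' u : F u -> (0 < t u)%R -> \esum_(z in A) (w z u)%:E = 1.
Proof.
move=> Fu tu; rewrite esumA//.
rewrite (eq_bigr (fun j => (Q j u / t u)%:E)) => [|j _].
  by rewrite sumEFin -mulr_suml -tE// divff// gt_eqF.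
rewrite mulrC EFinM; have [_ _ <-] := EQ j.
rewrite -esumZl ?invr_ge0// => [|e]; last by rewrite lee_fin mulr_ge0 ?sqabs_ge0.
by apply: eq_esum => e _; rewrite -EFinM /w /= sqabs_ipC mulrC.
Qed.

Lemma schatten_mccarthy_ge1 : (1 <= q)%R ->
  \sum_j \esum_(e in E j) (s j e `^ q)%:E <= \esum_(u in F) (t u `^ q)%:E.
Proof.
move=> q1; rewrite -(esumA (f := fun z => s z.1 z.2 `^ q)%R); last first.
  by move=> z; exact: powR_ge0.
apply: (majorization_ge1 (w := w)) => // u Fu.
have := t0 u; rewrite le_eqVlt => /predU1P[tu|tu]; last by rewrite sumw'.
by rewrite esum1// => z _; rewrite /w -tu invr0 mulr0.
Qed.

Lemma schatten_mccarthy_le1 : (0 < q <= 1)%R ->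
  \esum_(u in F) (t u `^ q)%:E <= \sum_j \esum_(e in E j) (s j e `^ q)%:E.
Proof.
move=> q1; rewrite -(esumA (f := fun z => s z.1 z.2 `^ q)%R); last first.
  by move=> z; exact: powR_ge0.
exact: (majorization_le1 (w := w)).
Qed.

End sum_of_forms.

(** * Power mean inequality *)

Section power_mean.
Local Open Scope ereal_scope.
Variables (n : nat) (x : 'I_n -> \bar R) (q : R).
Hypotheses (n0 : (0 < n)%N) (x0 : forall i, 0 <= x i) (xfin : forall i, x i < +oo).

Let N i : R := (fine (x i) `^ q^-1)%R.
Let N0 i : (0 <= N i)%R. Proof. exact: powR_ge0. Qed.
Let n0' : (0 < n%:R :> R)%R. Proof. by rewrite ltr0n. Qed.
Let xE i : x i = (fine (x i))%:E.
Proof. by rewrite fineK// ge0_fin_numE. Qed.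
Let NE : \sum_i x i `^ q^-1 = (\sum_i N i)%R%:E.
Proof. by rewrite -sumEFin; apply: eq_bigr => i _; rewrite xE poweR_EFin. Qed.
Let sx : \sum_i x i = (\sum_i fine (x i))%R%:E.
Proof. by rewrite -sumEFin; apply: eq_bigr => i _; rewrite -xE. Qed.
Let sx0 : (0 <= \sum_i fine (x i))%R.
Proof. by apply: sumr_ge0 => i _; rewrite fine_ge0. Qed.
Let sumn : (\sum_(i < n) n%:R^-1 = 1 :> R)%R.
Proof. by rewrite sumr_const card_ord -[LHS]mulr_natr mulVf// gt_eqF. Qed.
Let NX i : q != 0%R -> (N i `^ q = fine (x i))%R.
Proof. by move=> q0; rewrite -powRrM mulVf// powRr1// fine_ge0. Qed.
Let nSN : q != 0%R -> (n%:R `^ (q^-1 - 1) * \sum_i N i =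
  n%:R `^ q^-1 * \sum_i n%:R^-1 * N i)%R.
Proof.
move=> q00; rewrite powRB; last by rewrite (gt_eqF n0') implybT.
by rewrite powRr1 ?(ltW n0')// -mulr_sumr mulrA.
Qed.
Let nST : ((\sum_i fine (x i)) `^ q^-1 =
  n%:R `^ q^-1 * (\sum_i n%:R^-1 * fine (x i)) `^ q^-1)%R.
Proof.
rewrite -powRM ?(ltW n0')//; last first.
  by rewrite -mulr_sumr mulr_ge0 ?invr_ge0 ?(ltW n0').
by rewrite -mulr_sumr mulVKf// gt_eqF.
Qed.

(** Jensen with equal weights [1 / n] at the numbers [N i = x i ^ (1 / q)]; writing sums as [n]
    times means produces the factor [n ^ (1 / q - 1)]. *)
Lemma power_mean_ge1 : (1 <= q)%R ->
  (n%:R `^ (q^-1 - 1))%:E * (\sum_i x i `^ q^-1) <= (\sum_i x i) `^ q^-1.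
Proof.
move=> q1; have q0 : (0 < q)%R by lra.
have q00 : q != 0%R by rewrite gt_eqF.
rewrite NE sx poweR_EFin -EFinM lee_fin nSN// nST ler_wpM2l ?powR_ge0//.
have nV (i : 'I_n) : (0 <= n%:R^-1 :> R)%R by rewrite invr_ge0 (ltW n0').
have := @jensen_sum_ge1 R 'I_n (fun=> n%:R^-1)%R N q q1 nV N0.
rewrite sumn => /(_ (lexx _)).
rewrite [X in (_ <= X)%R](eq_bigr (fun i => n%:R^-1 * fine (x i))%R); last first.
  by move=> i _; rewrite NX.
set m := (\sum_i _ * N i)%R => h.
have m0 : (0 <= m)%R by apply: sumr_ge0 => i _; rewrite mulr_ge0.
have -> : m = ((m `^ q) `^ q^-1)%R by rewrite -powRrM mulfV// powRr1.
apply: ge0_ler_powR => //; rewrite ?invr_ge0 ?(ltW q0) ?nnegrE ?powR_ge0//.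
by apply: sumr_ge0 => i _; rewrite mulr_ge0// fine_ge0.
Qed.

Lemma power_mean_le1 : (0 < q <= 1)%R ->
  (\sum_i x i) `^ q^-1 <= (n%:R `^ (q^-1 - 1))%:E * (\sum_i x i `^ q^-1).
Proof.
move=> q1; have /andP[q0 _] := q1.
have q00 : q != 0%R by rewrite gt_eqF.
rewrite NE sx poweR_EFin -EFinM lee_fin nSN// nST ler_wpM2l ?powR_ge0//.
have nV (i : 'I_n) : (0 <= n%:R^-1 :> R)%R by rewrite invr_ge0 (ltW n0').
have := @jensen_sum_le1 R 'I_n (fun=> n%:R^-1)%R N q q1 nV N0.
rewrite sumn => /(_ (lexx _)).
rewrite [X in (X <= _)%R](eq_bigr (fun i => n%:R^-1 * fine (x i))%R); last first.
  by move=> i _; rewrite NX.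
set m := (\sum_i _ * N i)%R => h.
have m0 : (0 <= m)%R by apply: sumr_ge0 => i _; rewrite mulr_ge0.
have -> : m = ((m `^ q) `^ q^-1)%R by rewrite -powRrM mulfV// powRr1.
apply: ge0_ler_powR => //; rewrite ?invr_ge0 ?(ltW q0) ?nnegrE ?powR_ge0//.
by apply: sumr_ge0 => i _; rewrite mulr_ge0// fine_ge0.
Qed.

End power_mean.

End TraceInequalities.

(** * The Gram sum of the family and the two inequalities *)

Section FinalInequality.
Set Implicit Arguments.
Unset Strict Implicit.
Variables (R : realType) (H : completeNormedModType R[i]).
Variable ip : {dot H for Num.conj}.
Hypothesis hip : norm_from_dot ip.
Local Notation sqn := (sqn ip).

Lemma psd_sum (J : finType) (X : J -> H -> H) : (forall j, psd ip (X j)) ->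
  (forall j, seq_compact_op ip (X j)) ->
  psd ip (\sum_j X j) /\ forall x, quad ip (\sum_j X j) x = \sum_j quad ip (X j) x.
Proof.
move=> pX cX; have [lS bS _] := seq_compact_op_sum cX.
have q x : quad ip (\sum_j X j) x = \sum_j quad ip (X j) x.
  by rewrite /quad fct_sumE ip_suml raddf_sum.
split=> //; split=> // [x y|x].
  rewrite !fct_sumE ip_suml (ipC ip x) ip_suml rmorph_sum; apply: eq_bigr => j _.
  by have [_ _ -> _] := pX j; exact: ipC.
by rewrite q sumr_ge0// => j _; have [] := pX j.
Qed.

Lemma sqn_mean (n : nat) (a : 'I_n -> H) (m : H) : \sum_i a i = n%:R *: m ->
  \sum_i sqn (a i) = \sum_i sqn (a i - m) + n%:R * sqn m.
Proof.
move=> am; under [in RHS]eq_bigr do rewrite sqnBE.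
rewrite sumrB big_split /= sumr_const card_ord -mulr_natl -mulr_sumr.
have -> : \sum_i complex.Re (ip (a i) m) = n%:R * sqn m; last by ring.
rewrite -raddf_sum -ip_suml am ipZl sqnE.
by rewrite -(rmorph_nat (@real_complex R)) -rmorphM.
Qed.

Lemma sqr_poweR (x : \bar R) (p : R) : 0 < p -> (0 <= x)%E ->
  ((x `^ p^-1) ^+ 2 = x `^ (p / 2)^-1)%E.
Proof.
move=> p0; case: x => [r r0| _|//].
  rewrite !poweR_EFin -EFin_expe -powR_mulrn ?powR_ge0// -powRrM.
  by congr (_ `^ _)%:E; field; rewrite gt_eqF.
by rewrite !poweRyr ?invr_eq0 ?gt_eqF ?divr_gt0.
Qed.

Section family.
Variables (n : nat) (A : 'I_n -> H -> H) (p : R).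
Hypotheses (n0 : (0 < n)%N) (p0 : 0 < p).
Hypothesis cA : forall i, seq_compact_op ip (A i).
Local Notation M := (op_mean A).
Local Notation N B := (schatten_norm ip p B ^+ 2)%E.

Lemma seq_compact_op_mean : seq_compact_op ip M.
Proof. exact/seq_compact_opZ/seq_compact_op_sum. Qed.

Lemma sqn_op_mean x :
  \sum_i sqn (A i x) = \sum_i sqn ((A i - M) x) + n%:R * sqn (M x).
Proof.
apply: sqn_mean; have -> : M x = n%:R^-1 *: (\sum_i A i) x by [].
by rewrite fct_sumE scalerA divff ?scale1r// pnatr_eq0 -lt0n.
Qed.

(** One diagonalization serves both decompositions, so that their traces are compared with the same
    number. *)
Lemma exists_gram_sum : exists F t,
  diagonalizes ip F t (fun x => \sum_i sqn (A i x)).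
Proof.
have bA i : bounded_op (A i) by apply/(bounded_opP hip); case: (cA i).
have pS i := (gram_psd hip (bA i)).1.
have cS i : seq_compact_op ip (adjoint ip (A i) \o A i).
  have [/(bounded_opP hip)[lA' bA'] _] := adjointP hip (bA i).
  exact: seq_compact_op_comp.
have [pX qX] := psd_sum pS cS.
have [_ _ cX] := seq_compact_op_sum cS.
have [F bF FX] := spectral_theorem pX cX.
exists F, (quad ip (\sum_i (adjoint ip (A i) \o A i))).
have := psd_diagonalizes hip pX bF FX.
congr diagonalizes; apply/funext => x; rewrite qX; apply: eq_bigr => i _.
exact: (gram_psd hip (bA i)).2.
Qed.

Lemma sqr_schatten_normE B : seq_compact_op ip B -> exists E s,
  diagonalizes ip E s (fun x => sqn (B x)) /\
  (N B = (\esum_(e in E) (s e `^ (p / 2))%:E) `^ (p / 2)^-1)%E.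
Proof.
move=> [lB bB cB]; have [|E [s [EB ->]]] := @schatten_normE _ _ _ hip B p _ cB p0.
  exact/(bounded_opP hip).
exists E, s; split=> //; apply: sqr_poweR => //.
by apply: esum_ge0 => e _; rewrite lee_fin powR_ge0.
Qed.

(* The mean is repeated [n] times so that the sum of the Gram forms of [B] is
   that of [A]. *)
Let B (j : 'I_n + 'I_n) : H -> H :=
  match j with inl i => A i - M | inr _ => M end.

Let cB j : seq_compact_op ip (B j).
Proof.
case: j => i /=; last exact: seq_compact_op_mean.
by apply: seq_compact_opB; [exact: cA|exact: seq_compact_op_mean].
Qed.

Let sumB (V : nmodType) (f : (H -> H) -> V) :
  \sum_j f (B j) = \sum_i f (A i - M) + f M *+ n.
Proof. by rewrite big_sumType /= sumr_const card_ord. Qed.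

Let sqnB x : \sum_i sqn (A i x) = \sum_j sqn (B j x).
Proof. by rewrite sqn_op_mean (sumB (fun T => sqn (T x))) mulr_natl. Qed.

(** Both sides are compared with [(sum_u t u ^ q) ^ (1 / q)] for [q = p / 2]: the left one through
    the power mean and [schatten_mccarthy_ge1] for the [A i], the right one through the triangle
    inequality for the [2 n] operators [B j]. *)
Lemma schatten_mean_ge2 : 2 <= p -> (forall i, N (A i) < +oo)%E ->
  ((n%:R `^ (2 / p - 1))%:E * \sum_(i < n) N (A i) <=
   \sum_(i < n) N (A i - M)%R + N M *+ n)%E.
Proof.
move=> p2 fA; have q1 : 1 <= p / 2 by lra.
have [F [t FQ]] := exists_gram_sum.
have /choice[EA EAP] := fun i => sqr_schatten_normE (cA i).
have /choice[sA {}EAP] := EAP.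
have /choice[EB EBP] := fun j => sqr_schatten_normE (cB j).
have /choice[sB {}EBP] := EBP.
rewrite -(sumB (fun T => N T)).
have -> : (\sum_j N (B j) =
    \sum_j (\esum_(e in EB j) (sB j e `^ (p / 2))%:E) `^ (p / 2)^-1)%E.
  by apply: eq_bigr => j _; rewrite (EBP j).2.
apply: le_trans (schatten_triangle_ge1 hip (fun j => (EBP j).1) FQ sqnB q1).
have tr0 (E : set H) (s : H -> R) : (0 <= \esum_(e in E) (s e `^ (p / 2))%:E)%E.
  by apply: esum_ge0 => e _; rewrite lee_fin powR_ge0.
have := schatten_mccarthy_ge1 hip (fun i => (EAP i).1) FQ (fun x => erefl) q1.
have q0 : 0 < p / 2 by lra.
move=> le1; apply: (@le_trans _ _
  ((\sum_i \esum_(e in EA i) (sA i e `^ (p / 2))%:E) `^ (p / 2)^-1)%E); last first.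
  apply: gt0_ler_poweR => //; rewrite ?invr_ge0 ?(ltW q0)// in_itv/= leey andbT//.
  by rewrite sume_ge0.
have -> : 2 / p = (p / 2)^-1 by field; rewrite gt_eqF.
under eq_bigr do rewrite (EAP _).2.
(* The power mean inequality compares finite quantities; finiteness of each trace is recovered from
   that of its power. *)
apply: power_mean_ge1 => // i.
have := fA i; rewrite (EAP i).2; apply: lty_poweRy.
by rewrite invr_eq0 gt_eqF.
Qed.

Lemma schatten_mean_le2 : p < 2 -> (forall i, N (A i) < +oo)%E ->
  (\sum_(i < n) N (A i - M)%R + N M *+ n <=
   (n%:R `^ (2 / p - 1))%:E * \sum_(i < n) N (A i))%E.
Proof.
move=> p2 fA; have q1 : 0 < p / 2 <= 1.
  by rewrite divr_gt0//= ler_pdivrMr// mul1r ltW.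
have [F [t FQ]] := exists_gram_sum.
have /choice[EA EAP] := fun i => sqr_schatten_normE (cA i).
have /choice[sA {}EAP] := EAP.
have /choice[EB EBP] := fun j => sqr_schatten_normE (cB j).
have /choice[sB {}EBP] := EBP.
rewrite -(sumB (fun T => N T)).
have -> : (\sum_j N (B j) =
    \sum_j (\esum_(e in EB j) (sB j e `^ (p / 2))%:E) `^ (p / 2)^-1)%E.
  by apply: eq_bigr => j _; rewrite (EBP j).2.
apply: le_trans (schatten_triangle_le1 hip (fun j => (EBP j).1) FQ sqnB q1) _.
have tr0 (E : set H) (s : H -> R) : (0 <= \esum_(e in E) (s e `^ (p / 2))%:E)%E.
  by apply: esum_ge0 => e _; rewrite lee_fin powR_ge0.
have := schatten_mccarthy_le1 hip (fun i => (EAP i).1) FQ (fun x => erefl) q1.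
have /andP[q0 _] := q1.
move=> le1; apply: (@le_trans _ _
  ((\sum_i \esum_(e in EA i) (sA i e `^ (p / 2))%:E) `^ (p / 2)^-1)%E).
  apply: gt0_ler_poweR => //; rewrite ?invr_ge0 ?(ltW q0)// in_itv/= leey andbT//.
  by rewrite sume_ge0.
have -> : 2 / p = (p / 2)^-1 by field; rewrite gt_eqF.
under [in leRHS]eq_bigr do rewrite (EAP _).2.
apply: power_mean_le1 => // i.
have := fA i; rewrite (EAP i).2; apply: lty_poweRy.
by rewrite invr_eq0 gt_eqF.
Qed.

End family.
End FinalInequality.

Theorem theorem2p11 (R : realType) (H : completeNormedModType R[i])
    (ip : {dot H for Num.conj}) (hip : norm_from_dot ip)
    (hsep : separable_space H)
    (n : nat) (hn : (0 < n)%N) (p : R) (hp : 0 < p)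
    (A : 'I_n -> H -> H) (hA : forall i, schatten_class ip p (A i)) :
  (p < 2 ->
    (\sum_(i < n) schatten_norm ip p (A i - op_mean A)%R ^+ 2
      <= (n%:R `^ (2 / p - 1))%:E * \sum_(i < n) schatten_norm ip p (A i) ^+ 2
         - n%:R%:E * schatten_norm ip p (op_mean A) ^+ 2)%E)
  /\
  (2 <= p ->
    ((n%:R `^ (2 / p - 1))%:E * \sum_(i < n) schatten_norm ip p (A i) ^+ 2
       - n%:R%:E * schatten_norm ip p (op_mean A) ^+ 2
      <= \sum_(i < n) schatten_norm ip p (A i - op_mean A)%R ^+ 2)%E).
Proof.
have cA i : seq_compact_op ip (A i) by exact: compact_op_seq_compact (hA i).1.
have fA i : (schatten_norm ip p (A i) ^+ 2 < +oo)%E.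
  have s0 : (0 <= schatten_norm ip p (A i))%E by exact: poweR_ge0.
  have := (hA i).2; rewrite -ge0_fin_numE// => fs.
  by rewrite -ge0_fin_numE ?expe_ge0// fin_numX.
set c := (n%:R `^ _)%:E; set S := (\sum_(i < n) schatten_norm ip p (A i) ^+ 2)%E.
have S0 : (0 <= S)%E by apply: sume_ge0 => i _; rewrite expe_ge0// poweR_ge0.
have cSfin : (c * S)%E \is a fin_num.
  rewrite fin_numM//; apply/sum_fin_numP => i _ _.
  by rewrite ge0_fin_numE ?expe_ge0 ?poweR_ge0.
have -> : (n%:R%:E * schatten_norm ip p (op_mean A) ^+ 2 =
    schatten_norm ip p (op_mean A) ^+ 2 *+ n)%E by rewrite mule_natl.
set m := (_ *+ n)%E.
have m0 : (0 <= m)%E.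
  by rewrite /m -mule_natl mule_ge0 ?lee_fin// expe_ge0// poweR_ge0.
split=> hp2.
- have le := schatten_mean_le2 hip hn hp cA hp2 fA.
  (* Finiteness of the norm of the mean is read off the inequality itself, which bounds [m] by the
     finite [c * S]; only then is [m] moved across. *)
  have mfin : m \is a fin_num.
    rewrite ge0_fin_numE//; apply: (@le_lt_trans _ _ (c * S)%E).
      apply: le_trans le; rewrite leeDr// sume_ge0// => i _.
      by rewrite expe_ge0// poweR_ge0.
    by rewrite -ge0_fin_numE// mule_ge0// lee_fin powR_ge0.
  by rewrite leeBrDr.
- have le := schatten_mean_ge2 hip hn hp cA hp2 fA.
  (* If the norm of the mean were infinite, the left side would be [-oo]. *)
  have [mfin|] := boolP (m \is a fin_num); first by rewrite leeBlDr.
  rewrite ge0_fin_numE// -leNgt leye_eq => /eqP ->.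
  by rewrite addeC addNye ?leNye.
Qed.
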